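(* Let $\alpha>\frac12$, $1\le p\le q\le\infty$, and let $u,v$ be weights. Then there is a constant $C>0$ such that $\|\mathscr{H}_\alpha f\|_{L_q^u}\le C\|f\|_{L_p^v}$ holds for every $f\in L_p^v$ if and only if the conditions $$\sup_{t>0}\left(\int_0^{1/t}x^{(\alpha+\frac32)q}u(x)^q\,dx\right)^{1/q}\left(\int_0^t x^{(\alpha+\frac32)p'}v(x)^{-p'}\,dx\right)^{1/p'}<\infty,$$ $$\sup_{t>0}\left(\int_{1/t}^\infty x^{(\alpha-\frac12)q}u(x)^q\,dx\right)^{1/q}\left(\int_t^\infty x^{(\alpha-\frac12)p'}v(x)^{-p'}\,dx\right)^{1/p'}<\infty$$ hold simultaneously.
   Context: A weight is a positive locally integrable function on $\mathbb{R}_+=(0,\infty)$. $p'$ is the Hölder conjugate of $p$. $\|f\|_{L_p^v}=\left(\int_0^\infty v(x)^p|f(x)|^p\,dx\right)^{1/p}$, with the obvious modification for $p=\infty$ (i.e. $\operatorname{ess\,sup} v|f|$); $L_p^v$ is the space of measurable $f$ with $\|f\|_{L_p^v}<\infty$. In the displayed conditions, when $q=\infty$ or $p'=\infty$ the corresponding factor $\left(\int_E |g|^r\right)^{1/r}$ is read as the $L_\infty(E)$ norm of $g$. The Struve function is $$\mathbf{H}_\alpha(x)=\left(\frac x2\right)^{\alpha+1}\sum_{k=0}^\infty\frac{(-1)^k(x/2)^{2k}}{\Gamma(k+3/2)\Gamma(k+\alpha+3/2)},$$ and the $\mathscr{H}_\alpha$ (Struve) transform is $\mathscr{H}_\alpha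 f(y)=\int_0^\infty (xy)^{1/2}f(x)\mathbf{H}_\alpha(xy)\,dx$, $y>0$. Standing assumption: functions $f$ to which the transform is applied are such that the integrand is integrable on compact subsets of $\mathbb{R}_+$ for every $y>0$ and $\lim_{N\to\infty}\int_0^N (xy)^{1/2}f(x)\mathbf{H}_\alpha(xy)\,dx$ exists and is finite for every $y>0$. *)

(* Defs.v *)
From mathcomp Require Import all_boot all_order all_algebra.
From mathcomp Require Import all_classical all_reals all_analysis.
Set Implicit Arguments.
Unset Strict Implicit.
Unset Printing Implicit Defensive.
Import Order.TTheory GRing.Theory Num.Theory.
Import numFieldNormedType.Exports.
Local Open Scope classical_set_scope.
Local Open Scope ring_scope.

Notation Rplus R := (`]0, +oo[%classic : set R).

Definition weight (R : realType) (w : R -> R) : Prop :=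
  (forall x, 0 < x -> 0 < w x) /\ locally_integrable (Rplus R) w.

(* The L_r(E) norm, 1 <= r <= +oo. Extending g by 0 outside E changes neither
   the integral of |g|^r nor, since |g| is nonnegative, the essential
   supremum of |g|. *)
Definition Lnorm_on (R : realType) (r : \bar R) (E : set R) (g : R -> R)
    : \bar R :=
  'N[@lebesgue_measure R]_r [ (EFin \o g) \_ E ].

Definition wnorm (R : realType) (r : \bar R) (w f : R -> R) : \bar R :=
  Lnorm_on r (Rplus R) (fun x => w x * f x).

Definition in_weighted_Lp (R : realType) (p : \bar R) (v f : R -> R) : Prop :=
  measurable_fun (Rplus R) f /\ (wnorm p v f < +oo)%E.

(* Only meaningful for 0 < s, where the integrand is integrable. *)
Definition Gamma (R : realType) (s : R) : R :=
  \int[@lebesgue_measure R]_(t in Rplus R) (t `^ (s - 1) * expR (- t)).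

Definition struve (R : realType) (a x : R) : R :=
  (x / 2) `^ (a + 1) *
  limn (fun n : nat => \sum_(0 <= k < n)
    ((-1) ^+ k * (x / 2) ^+ (2 * k)
       / (Gamma (k%:R + 3 / 2) * Gamma (k%:R + a + 3 / 2)))).

Definition struve_integrand (R : realType) (a : R) (f : R -> R) (y x : R) : R :=
  Num.sqrt (x * y) * f x * struve a (x * y).

Definition struve_partial (R : realType) (a : R) (f : R -> R) (y N : R)
    : \bar R :=
  (\int[@lebesgue_measure R]_(x in `]0%R, N[) (struve_integrand a f y x)%:E)%E.

Definition struve_transform (R : realType) (a : R) (f : R -> R) (y : R) : R :=
  fine (lim (struve_partial a f y N @[N --> +oo%R])).

(* The truncated integrals take values in \bar R. If the integrand is not
   integrable near 0, they are infinite for all N > 0 (the convention for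
   oo - oo is -oo), so a finite limit also forces integrability on ]0, N[. *)
Definition struve_admissible (R : realType) (a : R) (f : R -> R) : Prop :=
  forall y, 0 < y ->
    locally_integrable (Rplus R) (struve_integrand a f y) /\
    exists l : R, struve_partial a f y N @[N --> +oo%R] --> l%:E.

(* Main.v *)
Require Import Defs.
From mathcomp Require Import all_boot all_order all_algebra.
From mathcomp Require Import all_classical all_reals all_analysis.
From mathcomp Require Import ess_sup_inf measurable_realfun.
From mathcomp Require Import ring lra.
Set Implicit Arguments.
Unset Strict Implicit.
Unset Printing Implicit Defensive.
Import Order.TTheory GRing.Theory Num.Theory.
Import numFieldNormedType.Exports.
Local Open Scope classical_set_scope.
Local Open Scope ring_scope.

(** The kernel of the transform is z -> sqrt z H_a(z) at z = x y, and for a > 1/2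
    it is positive and comparable to min (z^(a + 3/2), z^(a - 1/2)). To see this,
    write Poisson's integral of the Struve function, integrated by parts, as
      sqrt z H_a(z) = D z^(a - 1/2) K(z),  D > 0,
      K(z) = int_0^1 (1 - cos (z sqrt (1 - r^g))) dr,  g = 1 / (a - 1/2).
    The identity is checked on power series ([struve_kernelE]): the moments
    int_0^1 (1 - r^g)^k dr and the Gamma factors of the Struve series satisfy the
    same recursion. Now K is nonnegative and bounded by 2 and by z^2; it is
    bounded below for large z because the cosine averages out, and below by a
    multiple of z^2 for small z because K (2 z) <= 4 K (z)
    ([struve_kernel_bounds]).

    Hence, for nonnegative f, the transform is comparable to
      y^(a + 3/2) int_0^(1/y) x^(a + 3/2) f(x) dx
        + y^(a - 1/2) int_(1/y)^oo x^(a - 1/2) f(x) dx,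
    the upper bound holding in absolute value for all f. The two Hardy operators
    differ only in the orientation of the half line, and all that follows treats
    both at once.

    Sufficiency ([hardy_conditions_sufficient]): each condition implies the
    weighted inequality for one Hardy operator ([hardy_inequality]), by cutting
    the half line at points where the primitive takes the values M / 2^(k+1),
    applying Hölder's inequality on each block and summing the blocks with
    p <= q ([trivIset_Lnorm_on_le]). Minkowski's inequality adds the two.

    Necessity ([hardy_conditions_necessary]): since the kernel is nonnegative, the
    transform of f >= 0 supported in ]0, t[ is at least a multiple of the first
    Hardy term for y < 1/t, and similarly for ]t, +oo[ and y > 1/t. The assumed
    inequality therefore bounds the integral of f against a power by the norm of
    v f, and duality ([converse_hoelder]) gives the condition at t. *)

(** * Weighted norms over subsets of the half line *)

(** For nonnegative functions monotonicity holds without measurability, the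
    integral being a supremum over simple functions below the integrand. Norms of
    the transform can therefore be compared with no measurability proof. *)
Lemma ge0_le_integralT d (T : measurableType d) (R : realType)
    (mu : {measure set T -> \bar R}) (f g : T -> \bar R) :
  (forall x, 0 <= f x)%E -> (forall x, f x <= g x)%E ->
  (\int[mu]_x f x <= \int[mu]_x g x)%E.
Proof.
move=> f0 fg; have g0 x : (0 <= g x)%E by exact: le_trans (f0 x) (fg x).
rewrite !ge0_integralTE//; apply: ge_ereal_sup => _ [h /= hf <-].
apply: ereal_sup_ubound; exists h => //= x; exact: le_trans (hf x) (fg x).
Qed.

Lemma ge0_le_poweR (R : realType) (r : R) (x y : \bar R) :
  0 <= r -> (0 <= x)%E -> (x <= y)%E -> (x `^ r <= y `^ r)%E.
Proof.
move=> r0 x0 xy; apply: gt0_ler_poweR => //; rewrite in_itv/= leey andbT//.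
exact: le_trans xy.
Qed.

Section Lnorm_on_lemmas.
Context {R : realType}.
Local Notation mu := (@lebesgue_measure R).
Implicit Types (p r : \bar R) (E F : set R) (f g : R -> R).

Lemma lebesgue_setT_gt0 : (0 < mu [set: R])%E.
Proof.
apply: (@lt_le_trans _ _ (mu `[0, 1])); first by rewrite lebesgue_measure_itv/= lte01 sube0 lte01.
by apply: le_measure; rewrite ?inE.
Qed.

Lemma le_Lnorm p (f g : R -> \bar R) : (0 < p)%E ->
  (forall x, `|f x| <= `|g x|)%E -> ('N[mu]_p[f] <= 'N[mu]_p[g])%E.
Proof.
rewrite unlock; case: p => [p||]//=.
- rewrite lte_fin => p0 fg; apply: ge0_le_poweR; first by rewrite invr_ge0 ltW.
    by apply: integral_ge0 => x _; exact: poweR_ge0.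
  apply: ge0_le_integralT => [x|x]; first exact: poweR_ge0.
  by apply: ge0_le_poweR; [rewrite ltW|exact: abse_ge0|exact: fg].
- move=> _ fg; rewrite lebesgue_setT_gt0; apply: le_ess_sup.
  by apply: nearW => x; exact: fg.
Qed.

Lemma Lnorm_onE p E f : Lnorm_on p E f = 'N[mu]_p[EFin \o (f \_ E)]%E.
Proof. by rewrite /Lnorm_on restrict_EFin. Qed.

Lemma Lnorm_on_ge0 p E f : (0 <= Lnorm_on p E f)%E.
Proof. exact: Lnorm_ge0. Qed.

Lemma le_Lnorm_on p E F f g : (0 < p)%E -> E `<=` F ->
  (forall x, E x -> `|f x| <= `|g x|) ->
  (Lnorm_on p E f <= Lnorm_on p F g)%E.
Proof.
move=> p0 EF fg; apply: le_Lnorm => // x; rewrite !patchE.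
case: ifPn => [|_]; last by rewrite abse0 abse_ge0.
by rewrite inE => Ex; rewrite mem_set//=; [rewrite lee_fin; exact: fg|exact: EF].
Qed.

Lemma eq_Lnorm_on p E f g : (forall x, E x -> f x = g x) ->
  Lnorm_on p E f = Lnorm_on p E g.
Proof.
move=> fg; apply: eq_Lnorm => x; rewrite !patchE.
by case: ifPn => //; rewrite inE => Ex /=; rewrite fg.
Qed.

Lemma Lnorm_on_fin (p : R) E f : 0 < p ->
  Lnorm_on p%:E E f = ((\int[mu]_(x in E) (`|f x| `^ p)%:E) `^ p^-1)%E.
Proof.
move=> p0; rewrite Lnorm_onE unlock [in RHS]integral_mkcond; congr (_ `^ _)%E.
apply: eq_integral => x _; rewrite !patchE/= !patchE; case: ifPn => //.
by rewrite normr0 powR0// gt_eqF.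
Qed.

Lemma Lnorm_on_fin_power (p : R) E f : 0 < p ->
  (Lnorm_on p%:E E f `^ p)%E = (\int[mu]_(x in E) (`|f x| `^ p)%:E)%E.
Proof.
move=> p0; rewrite Lnorm_on_fin// -poweRrM mulVf ?gt_eqF// poweRe1//.
by apply: integral_ge0 => x _; rewrite lee_fin powR_ge0.
Qed.

(** The bound may be infinite, so that estimates can be glued over countably
    many sets before finiteness is known. *)
Lemma Lnorm_on_yP E f (y : \bar R) : (0 <= y)%E ->
  (Lnorm_on +oo%E E f <= y)%E <-> {ae mu, forall x, E x -> (`|f x|%:E <= y)%E}.
Proof.
move=> y0; rewrite Lnorm_onE unlock lebesgue_setT_gt0; split.
  move=> /ess_supP; apply: filterS => x /= + Ex.
  by rewrite patchE mem_set.
move=> H; apply/ess_supP; move: H; apply: filterS; first exact: (ae_filter_ringOfSetsType mu).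
move=> x /= Ex.
by rewrite patchE; case: ifPn => [|_]; [rewrite inE => /Ex|rewrite normr0].
Qed.

Lemma Lnorm_onZl p (k : R) E f : measurable E -> measurable_fun E f ->
  0 <= k -> (1 <= p)%E ->
  (Lnorm_on p E (fun x => (k * f x)%R) = k%:E * Lnorm_on p E f)%E.
Proof.
move=> mE mf k0; case: p => [p||//].
- rewrite lee_fin => p1; have p0 : 0 < p by exact: lt_le_trans p1.
  rewrite !Lnorm_on_fin//.
  under eq_integral do rewrite normrM (ger0_norm k0) powRM// EFinM.
  rewrite ge0_integralZl//; last 2 first.
  + apply/measurable_EFinP; apply: measurableT_comp (measurable_powR _) _.
    exact: measurableT_comp.
  + by rewrite lee_fin powR_ge0.
  rewrite poweRM ?lee_fin ?powR_ge0//; last first.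
    by apply: integral_ge0 => x _; rewrite lee_fin powR_ge0.
  by rewrite poweR_EFin -powRrM divff ?gt_eqF// powRr1.
- move=> _; rewrite !Lnorm_onE unlock lebesgue_setT_gt0.
  rewrite -ess_supZl ?lebesgue_setT_gt0//; apply: eq_ess_sup.
  apply: nearW => x /=; rewrite !patchE; case: ifPn => _.
    by rewrite normrM (ger0_norm k0).
  by rewrite normr0 mule0.
Qed.

(** Monotone convergence for finite exponents; for the infinite exponent a
    countable union of null sets is null. *)
Lemma Lnorm_on_bigcup_le p (E_ : (set R)^nat) f (K : \bar R) : (1 <= p)%E ->
  (forall n, measurable (E_ n)) ->
  {homo E_ : n m / (n <= m)%N >-> (n <= m)%O} ->
  measurable_fun (\bigcup_n E_ n) f ->
  (forall n, (Lnorm_on p (E_ n) f <= K)%E) ->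
  (Lnorm_on p (\bigcup_n E_ n) f <= K)%E.
Proof.
move=> + mE ndE mf EK; have K0 : (0 <= K)%E by apply: le_trans (EK 0%N); exact: Lnorm_on_ge0.
case: p EK => [p||//] EK.
- rewrite lee_fin => p1; have p0 : 0 < p by exact: lt_le_trans p1.
  have H n : (\int[mu]_(x in E_ n) (`|f x| `^ p)%:E <= K `^ p)%E.
    rewrite -Lnorm_on_fin_power//.
    by apply: ge0_le_poweR; [rewrite ltW|exact: Lnorm_on_ge0|exact: EK].
  rewrite Lnorm_on_fin//.
  have mfp n : measurable_fun (E_ n) (fun x => (`|f x| `^ p)%:E).
    apply/measurable_EFinP; apply: measurableT_comp (measurable_powR _) _.
    apply: measurableT_comp => //; apply: measurable_funS mf; last exact: bigcup_sup.
    exact: bigcupT_measurable.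
  have powRf x : (0 <= (`|f x| `^ p)%:E)%E by rewrite lee_fin powR_ge0.
  rewrite -[leRHS](@poweRe1 _ K)// -(@divff _ p) ?gt_eqF// poweRrM.
  apply: ge0_le_poweR; first by rewrite invr_ge0 ltW.
    by apply: integral_ge0 => x _; rewrite lee_fin powR_ge0.
  have cvE : (\int[mu]_(x in E_ n) (`|f x| `^ p)%:E)%E @[n --> \oo] -->
      (\int[mu]_(x in \bigcup_n E_ n) (`|f x| `^ p)%:E)%E.
    exact: ge0_nondecreasing_set_cvg_integral.
  by rewrite -(cvg_lim _ cvE)//; apply: lime_le; [exact: cvgP cvE|exact: nearW].
- move=> _; apply/Lnorm_on_yP => //.
  have : {ae mu, forall x, forall n, E_ n x -> (`|f x|%:E <= K)%E}.
    by apply/ae_foralln => n; exact/Lnorm_on_yP.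
  apply: filterS; first exact: (ae_filter_ringOfSetsType mu).
  by move=> x H [n _]; exact: H.
Qed.

End Lnorm_on_lemmas.

(** * Hölder's inequality and its converse *)

Section hoelder_on.
Context {R : realType}.
Local Notation mu := (@lebesgue_measure R).
Implicit Types (p : \bar R) (E F : set R) (f g : R -> R).

Let hoelder_on_1y E f g : measurable E ->
  measurable_fun E f -> measurable_fun E g ->
  (\int[mu]_(x in E) `|f x * g x|%:E <=
   Lnorm_on 1 E f * Lnorm_on +oo E g)%E.
Proof.
move=> mE mf mg.
have -> : Lnorm_on 1 E f = (\int[mu]_(x in E) `|f x|%:E)%E.
  rewrite Lnorm_on_fin// invr1 poweRe1; last by apply: integral_ge0.
  by apply: eq_integral => x _; rewrite powRr1.
set K := Lnorm_on +oo E g; have K0 : (0 <= K)%E by exact: Lnorm_on_ge0.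
have mf' : measurable_fun E (fun x => `|f x|%:E).
  by apply/measurable_EFinP; exact: measurableT_comp.
rewrite -ge0_integralZr//; apply: ae_ge0_le_integral => //.
- by apply/measurable_EFinP; apply: measurableT_comp => //; exact: measurable_funM.
- by move=> x _; exact: mule_ge0.
- by apply: emeasurable_funM => //; exact: measurable_cst.
have /(Lnorm_on_yP _ _ K0).1 := lexx K.
apply: filterS; first exact: (ae_filter_ringOfSetsType mu).
by move=> x /= H /H gK; rewrite normrM EFinM lee_wpmul2l.
Qed.

Lemma hoelder_on p E f g : (1 <= p)%E -> measurable E ->
  measurable_fun E f -> measurable_fun E g ->
  (\int[mu]_(x in E) `|f x * g x|%:E <=
   Lnorm_on p E f * Lnorm_on (hoelder_conjugate p) E g)%E.
Proof.
case: p => [p||//] + mE mf mg; last first.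
  move=> _; rewrite hoelder_conjugatey muleC.
  under eq_integral do rewrite mulrC.
  exact: hoelder_on_1y.
rewrite lee_fin le_eqVlt => /predU1P[<-|p1].
  by rewrite hoelder_conjugate1; exact: hoelder_on_1y.
have p0 : 0 < p by exact: lt_trans p1.
have -> : hoelder_conjugate p%:E = (p / (p - 1))%:E.
  by rewrite /hoelder_conjugate/= gt_eqF// inver subr_eq0 gt_eqF.
have mfE : measurable_fun [set: R] (f \_ E) by apply/(measurable_restrictT f mE).
have mgE : measurable_fun [set: R] (g \_ E) by apply/(measurable_restrictT g mE).
have q0 : 0 < p / (p - 1) by rewrite divr_gt0// subr_gt0.
have pq : p^-1 + (p / (p - 1))^-1 = 1.
  by rewrite invf_div -{1}(div1r p) -mulrDl subrKC mulfV// gt_eqF.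
apply: (@le_trans _ _ 'N[mu]_1[EFin \o ((f \_ E) \* (g \_ E))%R]%E); last first.
  by rewrite !Lnorm_onE; exact: hoelder.
rewrite Lnorm1 [in leLHS]integral_mkcond; apply: ge0_le_integralT => x.
  by rewrite patchE; case: ifPn.
by rewrite /= !patchE; case: ifPn => //; rewrite mulr0 normr0.
Qed.

(** The fourth hypothesis says that X is at most the supremum of Y. If A is
    infinite, a finite bound forces every Y i, hence X, to vanish, and then
    the product is 0. *)
Lemma mule_sup_le (I : Type) (A X : \bar R) (C : R) (Y : I -> \bar R) :
  (0 <= A)%E -> 0 <= C -> (forall i, 0 <= Y i)%E ->
  (forall K : \bar R, (0 <= K)%E -> (forall i, Y i <= K)%E -> (X <= K)%E) ->
  (forall i, A * Y i <= C%:E)%E -> (A * X <= C%:E)%E.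
Proof.
move=> A0 C0 Y0 XY H.
have [->|An0] := eqVneq A 0%E; first by rewrite mul0e.
have Agt0 : (0 < A)%E by rewrite lt0e An0.
case: A A0 An0 Agt0 H => [A| |//] A0 An0 Agt0 H.
- have : (X <= (A^-1 * C)%:E)%E.
    apply: XY => [|i]; first by rewrite lee_fin mulr_ge0// invr_ge0 -lee_fin.
    by rewrite EFinM lee_pdivlMl// -lte_fin.
  by rewrite EFinM lee_pdivlMl// -lte_fin.
- have : (X <= 0)%E.
    apply: XY => // i; rewrite leNgt; apply/negP => Yi.
    by have := H i; rewrite gt0_mulye// leye_eq.
  rewrite le_eqVlt => /predU1P[->|X0]; first by rewrite mule0.
  by rewrite lt0_mulye// leNye.
Qed.

(** Testing against phi recovers the dual norm of g: for 1 < p < +oo the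
    extremal phi is the power of g of exponent p' - 1, for p = +oo it is
    constant, and for p = 1 it is the indicator of a superlevel set of g.
    Cutting these down to the sets S n where both the variable and g are
    bounded makes phi bounded with bounded support and all norms finite, so
    that a common factor can be cancelled; S n increases to E. The extra
    factor A is kept inside, since it is not known to be finite. *)
Lemma converse_hoelder p E g (A : \bar R) (C : R) : (1 <= p)%E ->
  measurable E -> E `<=` Rplus R -> measurable_fun E g ->
  (forall x, E x -> 0 <= g x) -> (0 <= A)%E -> 0 <= C ->
  (forall (n : nat) (M : R) (phi : R -> R), measurable_fun [set: R] phi ->
     (forall x, 0 <= phi x <= M) ->
     (forall x, phi x != 0 -> [/\ E x, x < n%:R & g x <= n%:R]) ->
     (A * \int[mu]_(x in E) (g x * phi x)%:E <= C%:E * Lnorm_on p E phi)%E) ->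
  (A * Lnorm_on (hoelder_conjugate p) E g <= C%:E)%E.
Proof.
move=> p1 mE E0 mg g0 A0 C0 H.
pose S n := E `&` [set x | x < n%:R /\ g x <= n%:R].
have mS n : measurable (S n).
  have -> : S n = (E `&` (g @^-1` `]-oo, n%:R])) `&` `]-oo, n%:R[.
    apply/seteqP; split => x; rewrite /S /= !in_itv/=; first by move=> [? []].
    by move=> [[? ?] ?].
  by apply: measurableI => //; exact: mg.
have ndS : {homo S : n m / (n <= m)%N >-> (n <= m)%O}.
  move=> n m nm; apply/subsetPset => x [Ex [xn gn]]; split => //.
  have nmR : n%:R <= m%:R :> R by rewrite ler_nat.
  by split; [exact: lt_le_trans nmR|exact: le_trans nmR].
have SE : \bigcup_n S n = E.
  apply/seteqP; split => [x [n _ []]//|x Ex].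
  exists (Num.trunc (Num.max x (g x))).+1 => //; split => //.
  have := truncnS_gt (Num.max x (g x)); rewrite gt_max => /andP[xlt glt].
  by split => //; exact: ltW.
apply: (@mule_sup_le nat _ _ _ (fun n => Lnorm_on (hoelder_conjugate p) (S n) g)) => //.
- by move=> n; exact: Lnorm_on_ge0.
- move=> K K0 HK; rewrite -SE; apply: Lnorm_on_bigcup_le => //.
    exact: hoelder_conj_ge1.
  by rewrite SE.
move=> n; have mgS : measurable_fun (S n) g by apply: measurable_funS mg => // x [].
have SnE x : S n x -> [/\ E x, x < n%:R & g x <= n%:R] by move=> [? []].
have muS : (mu (S n) < +oo)%E.
  apply: (@le_lt_trans _ _ (mu `]0, n%:R[)).
    apply: le_measure; rewrite ?inE; [exact: mS|exact: measurable_itv|].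
    move=> x [/E0 + [xn _]]; by rewrite /= !in_itv/= xn => /andP[->].
  by rewrite lebesgue_measure_itv/=; case: ifPn; rewrite -?EFinD ltry.
have patch_neq0 (h : R -> R) x : (h \_ (S n)) x != 0 -> S n x.
  by rewrite patchE; case: ifPn => [|_]; rewrite ?inE// eqxx.
(* the test function g^r on S n; r = p' - 1 when 1 < p, and r = 0 when p = +oo *)
have key (r : R) : 0 <= r ->
    (A * \int[mu]_(x in S n) (g x `^ (r + 1))%:E <=
     C%:E * Lnorm_on p (S n) (fun x => (g x `^ r)%R))%E.
  move=> r0; pose phi := (fun x => g x `^ r) \_ (S n).
  have mphi : measurable_fun [set: R] phi.
    apply/(measurable_restrictT _ (mS n)).
    exact: measurableT_comp (measurable_powR _) mgS.
  have := H n (n%:R `^ r) phi mphi.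
  have -> : (\int[mu]_(x in E) (g x * phi x)%:E =
             \int[mu]_(x in S n) (g x `^ (r + 1))%:E)%E.
    rewrite [RHS]integral_mkcond [LHS]integral_mkcond; apply: eq_integral => x _.
    rewrite /phi !patchE; case: (ifPn (x \in S n)) => [|_].
      rewrite inE => -[Ex _]; rewrite mem_set// mulrC -{2}(powRr1 (g0 _ Ex)) powRD//.
      by rewrite gt_eqF// ltr_wpDl.
    by case: ifPn => //; rewrite mulr0.
  have -> : Lnorm_on p E phi = Lnorm_on p (S n) (fun x => g x `^ r).
    rewrite !Lnorm_onE; apply: eq_Lnorm => x; rewrite /phi /= !patchE.
    by case: ifPn => // /negP xE; case: ifPn => //; rewrite inE => -[/mem_set].
  apply.
  - move=> x; rewrite /phi patchE; case: ifPn => [|_]; last by rewrite lexx powR_ge0.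
    rewrite inE => /SnE[Ex _ gn]; rewrite powR_ge0 ge0_ler_powR// nnegrE ?g0//.
  - by move=> x /patch_neq0/SnE.
have intg (r : R) : 0 <= r -> exists2 i : R, 0 <= i &
    (\int[mu]_(x in S n) (g x `^ r)%:E)%E = i%:E.
  move=> r0; pose I := (\int[mu]_(x in S n) (g x `^ r)%:E)%E.
  have I0 : (0 <= I)%E by apply: integral_ge0 => x _; rewrite lee_fin powR_ge0.
  suff Ioo : (I < +oo)%E.
    by exists (fine I); [exact: fine_ge0|rewrite fineK// ge0_fin_numE//].
  apply: (@le_lt_trans _ _ (\int[mu]_(x in S n) (n%:R `^ r)%:E)%E).
    apply: ge0_le_integral => //.
    - exact: mS.
    - by move=> x _; rewrite lee_fin powR_ge0.
    - by apply/measurable_EFinP; exact: measurableT_comp (measurable_powR _) mgS.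
    - move=> x /SnE[Ex _ gn]; rewrite lee_fin ge0_ler_powR// nnegrE ?g0//.
  rewrite integral_cst; last exact: mS.
  by rewrite lte_mul_pinfty// lee_fin powR_ge0.
have LnormE (r : R) : 0 < r ->
    Lnorm_on r%:E (S n) g = ((\int[mu]_(x in S n) (g x `^ r)%:E) `^ r^-1)%E.
  move=> r0.
  rewrite (Lnorm_on_fin _ _ r0).
  congr poweR.
  apply: eq_integral => x.
  by rewrite inE => /SnE[Ex _ _]; rewrite ger0_norm ?g0.
case: p p1 H key => [p||//] p1 H key; last first.
  rewrite hoelder_conjugatey LnormE// invr1 poweRe1; last first.
    by apply: integral_ge0 => x _; rewrite lee_fin powR_ge0.
  have := key 0 (lexx _); rewrite add0r => /le_trans; apply.
  rewrite -[leRHS]mule1 lee_wpmul2l ?lee_fin//; apply/Lnorm_on_yP => //.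
  by apply: nearW => x _; rewrite powRr0 normr1.
rewrite lee_fin in p1; have p0 : 0 < p by exact: lt_le_trans p1.
move: p1; rewrite le_eqVlt => /predU1P[p1|p1]; last first.
  have -> : hoelder_conjugate p%:E = (p / (p - 1))%:E.
    by rewrite /hoelder_conjugate/= gt_eqF// inver subr_eq0 gt_eqF.
  set q := p / (p - 1).
  have p10 : 0 < p - 1 by rewrite subr_gt0.
  have q0 : 0 < q by rewrite divr_gt0.
  have q1E : q - 1 = (p - 1)^-1 by rewrite /q; field; rewrite gt_eqF.
  have q1 : 0 <= q - 1 by rewrite q1E invr_ge0 ltW.
  have qV : q^-1 + p^-1 = 1 by rewrite /q; field; rewrite !gt_eqF.
  have qp : (q - 1) * p = q by rewrite q1E mulrC.
  rewrite LnormE//; have := key _ q1; rewrite subrK Lnorm_on_fin//.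
  have -> : (\int[mu]_(x in S n) (`|g x `^ (q - 1)| `^ p)%:E =
             \int[mu]_(x in S n) (g x `^ q)%:E)%E.
    by apply: eq_integral => x _; rewrite ger0_norm ?powR_ge0// -powRrM qp.
  have [i i0 ->] := intg q (ltW q0); rewrite !poweR_EFin.
  move: i0; rewrite le_eqVlt => /predU1P[<-|i0] Ai.
    by rewrite powR0 ?invr_neq0 ?gt_eqF// mule0.
  have : (A * (i `^ q^-1)%:E * (i `^ p^-1)%:E <= C%:E * (i `^ p^-1)%:E)%E.
    by rewrite -muleA -EFinM -powRD ?qV ?powRr1 ?oner_eq0//; exact: ltW.
  by rewrite lee_pmul2r// lte_fin powR_gt0.
subst p; rewrite hoelder_conjugate1; set X := Lnorm_on +oo _ _.
have X0 : (0 <= X)%E by exact: Lnorm_on_ge0.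
(* p = 1: the essential supremum is the supremum of the levels l below it *)
apply: (@mule_sup_le {l : R | 0 <= l /\ (l%:E < X)%E} _ _ _ (fun l => (sval l)%:E)) => //.
- by move=> [l [l0 lX]]; rewrite lee_fin.
- move=> [k| |] // k0 HK; last by rewrite leey.
  rewrite leNgt; apply/negP => kX.
  have [l [kl lX]] : exists l, k < l /\ (l%:E < X)%E.
    case: X X0 kX {HK} => [x _|_ _|//]; last by exists (k + 1); rewrite ltrDl ltr01 ltry; split.
    by rewrite lte_fin => kx; exists ((k + x) / 2); rewrite lte_fin; split; lra.
  have l0 : 0 <= l by rewrite (le_trans _ (ltW kl)).
  by have := HK (exist _ l (conj l0 lX)); rewrite /= lee_fin leNgt kl.
move=> [l [l0 lX]] /=.
pose F := S n `&` [set x | l < g x].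
have mF : measurable F.
  rewrite /F (_ : [set x | _] = g @^-1` `]l, +oo[); last first.
    by apply/seteqP; split => x /=; rewrite in_itv/= andbT.
  by apply: mgS => //; exact: measurable_itv.
have Foo : (mu F < +oo)%E.
  apply: le_lt_trans muS; apply: le_measure; rewrite ?inE; [exact: mF|exact: mS|].
  by move=> x [].
have F0 : (0 < mu F)%E.
  rewrite lt0e measure_ge0 andbT; apply/negP => /eqP muF0.
  move: lX; rewrite ltNge => /negP; apply; apply/Lnorm_on_yP; first by rewrite lee_fin.
  exists F; split; [exact: mF|exact: muF0|move=> x /= /not_implyP[Sx /negP]].
  rewrite -ltNge lte_fin => lg; split => //=.
  by rewrite -(ger0_norm (g0 _ _))//; case: Sx.
have := H n 1 (\1_F) (measurable_indic _).
have -> : Lnorm_on 1 E \1_F = mu F.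
  rewrite Lnorm_on_fin// invr1 poweRe1; last first.
    by apply: integral_ge0 => x _; rewrite lee_fin powR_ge0.
  under eq_integral do rewrite ger0_norm// powRr1//.
  rewrite integral_indic//; congr (mu _); apply/setIidl => x [] [] //.
move=> /(_ mF) HH.
have {}HH : (A * \int[mu]_(x in E) (g x * \1_F x)%:E <= C%:E * mu F)%E.
  apply: HH => [x|x]; first by rewrite indicE; case: (_ \in _) => /=; rewrite ?lexx ler01.
  by rewrite indicE; case: (boolP (x \in F)) => [|_]; rewrite ?eqxx// inE => -[/SnE].
rewrite -(@fineK _ (mu F)) ?ge0_fin_numE// in HH.
have mF0 : 0 < fine (mu F) by rewrite fine_gt0// F0.
have : (A * l%:E * (fine (mu F))%:E <= C%:E * (fine (mu F))%:E)%E.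
  apply: le_trans HH; rewrite -muleA lee_wpmul2l// fineK ?ge0_fin_numE//.
  have <- : (\int[mu]_(x in F) l%:E = l%:E * mu F)%E.
    by rewrite integral_cst//; exact: mF.
  rewrite [leLHS]integral_mkcond [leRHS]integral_mkcond.
  apply: ge0_le_integralT => x; rewrite !patchE; first by case: ifPn.
  case: ifPn => [|xF]; rewrite ?inE.
    move=> Fx; have [[Ex _] lg] := Fx; rewrite mem_set//= indicE mem_set// mulr1.
    by rewrite lee_fin ltW.
  case: ifPn => //; rewrite inE => Ex; rewrite lee_fin mulr_ge0//; exact: g0.
by rewrite lee_pmul2r.
Qed.

End hoelder_on.

(** * Half lines of either orientation *)

Section half_lines.
Context {R : realType}.
Local Notation mu := (@lebesgue_measure R).
Implicit Types (b : bool) (s t x y : R).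

(** The two Hardy operators integrate over ]0, t[ and over ]t, +oo[. The boolean
    selects one of them, so that a single argument covers both. *)
Definition half_line (b : bool) t : set R :=
  if b then `]0%R, t[%classic else `]t, +oo[%classic.

Lemma half_lineP b t x : half_line b t x = (if b then 0 < x < t : Prop else t < x : Prop).
Proof. by case: b; rewrite /half_line /= in_itv/= ?andbT. Qed.

Lemma measurable_half_line b t : measurable (half_line b t).
Proof. by case: b; exact: measurable_itv. Qed.

Lemma half_line_gt0 b t : 0 < t -> half_line b t `<=` Rplus R.
Proof.
move=> t0 x; rewrite half_lineP /= in_itv/= andbT.
by case: b => [/andP[]//|]; exact: lt_trans.
Qed.

(** The inversion t -> 1/t exchanges the variable and the endpoint of a half
    line while keeping its orientation; this is why both weighted norms in
    a condition carry the same orientation. *)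
Lemma half_line_inv b s t : 0 < s -> 0 < t -> half_line b s^-1 t = half_line b t^-1 s.
Proof.
move=> s0 t0; rewrite !half_lineP s0 t0/=.
have e : (t < s^-1) = (s < t^-1) by rewrite -[in RHS](invrK s) ltf_pV2 ?posrE ?invr_gt0.
have e' : (s^-1 < t) = (t^-1 < s) by rewrite -[in RHS](invrK s) ltf_pV2 ?posrE ?invr_gt0.
by case: b; rewrite ?e ?e'.
Qed.

Lemma half_line_total b s t : 0 < t -> half_line b s `<=` half_line b t \/ half_line b s t.
Proof.
move=> t0; have [st|ts] := leP s t; case: b.
- by left => x; rewrite !half_lineP => /andP[-> xs] /=; exact: lt_le_trans xs st.
- move: st; rewrite le_eqVlt => /predU1P[->|st]; first by left.
  by right; rewrite half_lineP.
- by right; rewrite half_lineP t0.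
- by left => x; rewrite !half_lineP; exact: lt_trans.
Qed.

Lemma half_line_sub b s t : half_line b t s -> half_line b s `<=` half_line b t.
Proof.
case: b => + x; rewrite !half_lineP; last by move=> ts; exact: lt_trans.
by move=> /andP[_ st] /andP[-> /=] /lt_trans; exact.
Qed.

Lemma half_line_irr b t : ~ half_line b t t.
Proof. by rewrite half_lineP; case: b; rewrite ltxx ?andbF. Qed.

Lemma half_line_measure_gt0 b t : 0 < t -> (0 < mu (half_line b t))%E.
Proof.
move=> t0; case: b; rewrite /half_line lebesgue_measure_itv/= ?lte_fin ?t0 ?ltry//.
by rewrite sube0 lte_fin.
Qed.

(** Endpoints tending to +oo or to 0 according to the orientation. *)
Definition exhaust b (n : nat) : R := if b then n.+1%:R else n.+1%:R^-1.

Lemma exhaust_gt0 b n : 0 < exhaust b n.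
Proof. by case: b; rewrite /exhaust ?invr_gt0. Qed.

Lemma exhaust_before b x n m : (n <= m)%N ->
  half_line b x (exhaust b m) -> half_line b x (exhaust b n).
Proof.
move=> nm; have nmR : n.+1%:R <= m.+1%:R :> R by rewrite ler_nat.
rewrite !half_lineP; case: b => /=.
  by move=> /andP[_ mx]; rewrite ltr0Sn (le_lt_trans nmR).
by move=> /lt_le_trans; apply; rewrite lef_pV2 ?posrE.
Qed.

Lemma exhaustP b y : 0 < y -> exists n, half_line b y `<=` half_line b (exhaust b n).
Proof.
move=> y0; case: b.
  exists (Num.trunc y) => x; rewrite !half_lineP => /andP[->/=] /lt_trans; apply.
  exact: truncnS_gt.
exists (Num.trunc y^-1) => x; rewrite !half_lineP; apply: lt_trans.
by rewrite -[ltRHS]invrK ltf_pV2 ?posrE ?invr_gt0// truncnS_gt.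
Qed.

End half_lines.

Section monotone_measurable.
Context {R : realType}.

(** Preimages of rays are intervals. *)
Lemma nondecreasing_measurable_pos (f : R -> R) :
  (forall s t, 0 < s -> s <= t -> f s <= f t) -> measurable_fun (Rplus R) f.
Proof.
move=> f_nd; apply: (measurability (@RGenCInfty.G R)) => [|/= _ [_] [r] -> <-].
  exact: RGenCInfty.measurableE.
apply: is_interval_measurable => s t/=.
rewrite !in_itv/= !andbT => -[s0 fs] [t0 ft] u /andP[su ut].
rewrite !in_itv/= !andbT; split; first exact: lt_le_trans s0 su.
by apply: le_trans fs _; exact: f_nd.
Qed.

Lemma measurable_inv_pos (w : R -> R) : (forall x, 0 < x -> 0 < w x) ->
  measurable_fun (Rplus R) w -> measurable_fun (Rplus R) (fun x => (w x)^-1).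
Proof.
move=> w0 mw; apply: (eq_measurable_fun (fun x => w x `^ (-1))).
  by move=> x; rewrite inE/= in_itv/= andbT => x0; rewrite powR_inv1// ltW// w0.
exact: measurableT_comp (measurable_powR _) mw.
Qed.

End monotone_measurable.

(** * Positivity of norms and gluing of blocks *)

Section glue.
Context {R : realType}.
Local Notation mu := (@lebesgue_measure R).
Implicit Types (p q : \bar R).

Lemma Lnorm_on_gt0 p (E : set R) (f : R -> R) : (0 < p)%E -> measurable E ->
  (0 < mu E)%E -> measurable_fun E f -> (forall x, E x -> 0 < f x) ->
  (0 < Lnorm_on p E f)%E.
Proof.
move=> p0 mE E0 mf f0; rewrite lt0e Lnorm_on_ge0 andbT; apply/negP => /eqP.
rewrite Lnorm_onE => /Lnorm_eq0_eq0 => /(_ _ p0) [].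
  by apply/measurable_EFinP; apply/(measurable_restrictT f mE).
move=> N [mN N0 sN]; move: E0; apply/negP; rewrite -leNgt -N0.
apply: le_measure; rewrite ?inE; [exact: mE|exact: mN|].
move=> x Ex; apply: sN => /= /(_ I); rewrite patchE mem_set//= => -[] /eqP.
by rewrite gt_eqF// f0.
Qed.

(** This is the inclusion of l^p in l^q, and the only place where p <= q is
    essential: with N the total norm of w and x_k the norm of w on the k-th
    block, x_k <= N gives x_k^q <= N^(q - p) x_k^p, and the p-th powers add up
    to N^p. *)
Lemma trivIset_Lnorm_on_le p q (Y X : (set R)^nat) (f w : R -> R) (K : R) :
  (1 <= p)%E -> (p <= q)%E -> 0 <= K ->
  (forall k, measurable (Y k)) -> trivIset setT Y ->
  (forall k, measurable (X k)) -> trivIset setT X ->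
  measurable_fun (\bigcup_k Y k) f -> measurable_fun (\bigcup_k X k) w ->
  (forall k, Lnorm_on q (Y k) f <= K%:E * Lnorm_on p (X k) w)%E ->
  (Lnorm_on p (\bigcup_k X k) w < +oo)%E ->
  (Lnorm_on q (\bigcup_k Y k) f <= K%:E * Lnorm_on p (\bigcup_k X k) w)%E.
Proof.
move=> p1 + K0 mY tY mX tX mf mw H Noo; have p0 : (0 < p)%E by exact: lt_le_trans p1.
have XX k : (Lnorm_on p (X k) w <= Lnorm_on p (\bigcup_k X k) w)%E.
  by apply: le_Lnorm_on => //; exact: bigcup_sup.
have N0 : (0 <= Lnorm_on p (\bigcup_k X k) w)%E by exact: Lnorm_on_ge0.
case: q H => [q||]; last 2 first.
- move=> H _; apply/Lnorm_on_yP; first exact: mule_ge0.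
  have : {ae mu, forall x, forall k, Y k x ->
      (`|f x|%:E <= K%:E * Lnorm_on p (\bigcup_k X k) w)%E}.
    apply/ae_foralln => k; apply/Lnorm_on_yP; first exact: mule_ge0.
    by apply: le_trans (H k) _; rewrite lee_wpmul2l.
  apply: filterS; first exact: (ae_filter_ringOfSetsType mu).
  by move=> x h [k _]; exact: h.
- by move=> _; case: p p1 {p0 XX Noo N0}.
move=> H pq; case: p p0 p1 pq H Noo N0 XX => [p||//] p0 p1 pq H Noo N0 XX; last by [].
rewrite lte_fin in p0; rewrite lee_fin in p1; rewrite lee_fin in pq.
have q0 : 0 < q by exact: lt_le_trans pq.
set N := Lnorm_on _ _ w in Noo N0 XX *.
have Nfin : N = (fine N)%:E by rewrite fineK// ge0_fin_numE.
have n0 : 0 <= fine N by exact: fine_ge0.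
pose x k := fine (Lnorm_on p%:E (X k) w).
have xE k : Lnorm_on p%:E (X k) w = (x k)%:E.
  by rewrite /x fineK// ge0_fin_numE ?Lnorm_on_ge0// (le_lt_trans (XX k)).
have x0 k : 0 <= x k by rewrite -lee_fin -xE Lnorm_on_ge0.
have xN k : x k <= fine N by rewrite -lee_fin -xE -Nfin.
have mpow (r : R) (E : set R) (h : R -> R) : measurable_fun E h ->
    measurable_fun E (fun z => (`|h z| `^ r)%:E).
  move=> mh; apply/measurable_EFinP; apply: measurableT_comp (measurable_powR _) _.
  exact: measurableT_comp.
have int_ge0 (r : R) (E : set R) (h : R -> R) : (0 <= \int[mu]_(z in E) (`|h z| `^ r)%:E)%E.
  by apply: integral_ge0 => z _; rewrite lee_fin powR_ge0.
have split_pow (z : R) : z `^ q = z `^ (q - p) * z `^ p.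
  by rewrite -powRD subrK// gt_eqF.
have Iq : (\int[mu]_(y in \bigcup_k Y k) (`|f y| `^ q)%:E <= ((K * fine N) `^ q)%:E)%E.
  rewrite ge0_integral_bigcup//; [|exact: mpow].
  apply: (@le_trans _ _ (\sum_(k <oo) (K `^ q * fine N `^ (q - p))%:E *
      (x k `^ p)%:E)%E).
    apply: lee_nneseries => [k _ _|k _]; first exact: int_ge0.
    rewrite -Lnorm_on_fin_power//.
    apply: (@le_trans _ _ ((K * x k)%:E `^ q)%E).
      by apply: ge0_le_poweR; [exact: ltW|exact: Lnorm_on_ge0|rewrite EFinM -xE].
    rewrite poweR_EFin -EFinM lee_fin powRM// -mulrA ler_wpM2l ?powR_ge0//.
    rewrite (split_pow (x k)) ler_wpM2r ?powR_ge0//.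
    by rewrite ge0_ler_powR ?nnegrE ?subr_ge0.
  rewrite nneseriesZl; last by move=> k _; rewrite lee_fin powR_ge0.
  have -> : (\sum_(k <oo) (x k `^ p)%:E = (fine N `^ p)%:E)%E.
    rewrite -poweR_EFin -Nfin /N Lnorm_on_fin_power// ge0_integral_bigcup//; last exact: mpow.
    by apply: eq_eseriesr => k _; rewrite -poweR_EFin -xE Lnorm_on_fin_power.
  by rewrite -EFinM lee_fin -mulrA -split_pow powRM.
have -> : (K%:E * N = ((K * fine N) `^ q)%:E `^ q^-1)%E.
  by rewrite Nfin -EFinM poweR_EFin -powRrM divff ?gt_eqF// powRr1 ?mulr_ge0.
rewrite Lnorm_on_fin//; apply: ge0_le_poweR => //; first by rewrite invr_ge0 ltW.
Qed.

End glue.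

(** * The weighted Hardy inequality *)

Section hardy.
Context {R : realType}.
Local Notation mu := (@lebesgue_measure R).
Implicit Types (p q : \bar R) (b : bool) (h : R -> R) (s t x y : R).

Definition primitive b h t : \bar R := (\int[mu]_(x in half_line b t) (h x)%:E)%E.

Section primitive_theory.
Variables (b : bool) (h : R -> R).
Hypothesis mh : measurable_fun (Rplus R) h.
Hypothesis h0 : forall x, 0 < x -> 0 <= h x.

Let mhE t : 0 < t -> measurable_fun (half_line b t) (fun x => (h x)%:E).
Proof.
move=> t0; apply/measurable_EFinP; apply: measurable_funS mh; first exact: measurable_itv.
exact: half_line_gt0.
Qed.

Let h0E t x : 0 < t -> half_line b t x -> (0 <= (h x)%:E)%E.
Proof.
by move=> t0 /(half_line_gt0 t0); rewrite /= in_itv/= andbT lee_fin => /h0.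
Qed.

Lemma primitive_ge0 t : 0 < t -> (0 <= primitive b h t)%E.
Proof. by move=> t0; apply: integral_ge0 => x; exact: h0E. Qed.

Lemma primitive_le s t : 0 < s -> 0 < t -> half_line b s `<=` half_line b t ->
  (primitive b h s <= primitive b h t)%E.
Proof.
move=> s0 t0 st; apply: ge0_subset_integral => //.
- exact: measurable_half_line.
- exact: measurable_half_line.
- exact: mhE.
- by move=> x; exact: h0E.
Qed.

Hypothesis hoo : forall t, 0 < t -> (primitive b h t < +oo)%E.

Lemma primitiveE t : 0 < t -> primitive b h t = (fine (primitive b h t))%:E.
Proof. by move=> t0; rewrite fineK// ge0_fin_numE ?hoo// primitive_ge0. Qed.

Lemma fine_primitive_le s t : 0 < s -> 0 < t -> half_line b s `<=` half_line b t ->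
  fine (primitive b h s) <= fine (primitive b h t).
Proof. by move=> s0 t0 st; rewrite -lee_fin -!primitiveE//; exact: primitive_le. Qed.

Lemma measurable_primitive_inv :
  measurable_fun (Rplus R) (fun y => fine (primitive b h y^-1)).
Proof.
have [bE|bE] : b = true \/ b = false by case: (b); [left|right].
- rewrite -[X in measurable_fun _ X]opprK; apply: measurable_funN.
  apply: nondecreasing_measurable_pos => s t s0 st /=; rewrite lerN2.
  have t0 : 0 < t by exact: lt_le_trans st.
  apply: fine_primitive_le; rewrite ?invr_gt0// => x.
  rewrite !half_lineP bE => /andP[-> xt]/=; apply: lt_le_trans xt _.
  by rewrite lef_pV2 ?posrE.
- apply: nondecreasing_measurable_pos => s t s0 st /=.
  have t0 : 0 < t by exact: lt_le_trans st.
  apply: fine_primitive_le; rewrite ?invr_gt0// => x.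
  rewrite !half_lineP bE; apply: le_lt_trans.
  by rewrite lef_pV2 ?posrE.
Qed.

Let H := h \_ (Rplus R).

Let mH (A : set R) : measurable_fun A H.
Proof. by apply: measurable_funTS; apply/(measurable_restrictT h (measurable_itv _)). Qed.

Let H0 x : 0 <= H x.
Proof. by rewrite /H patchE; case: ifPn => //; rewrite inE/= in_itv/= andbT => /h0. Qed.

Let primitiveH t : 0 < t -> primitive b h t = (\int[mu]_(x in half_line b t) (H x)%:E)%E.
Proof.
move=> t0; apply: eq_integral => x; rewrite inE => /(half_line_gt0 t0) xP.
by rewrite /H patchE mem_set.
Qed.

(** The primitive is continuous, so the intermediate value theorem applies. For
    the orientation ]0, t[ it vanishes at 0. For the orientation ]t, +oo[ the
    theorem is applied on [T, K] to the difference between the value at T and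
    the value at t, with K so large that this difference exceeds the value at
    T minus c. *)
Lemma primitive_surj (T c : R) : 0 < T -> 0 < c < fine (primitive b h T) ->
  exists2 s, 0 < s & fine (primitive b h s) = c.
Proof.
move=> T0 /andP[c0 cT].
have finH (A : set R) t : 0 < t -> measurable A -> A `<=` half_line b t ->
    (\int[mu]_(x in A) (H x)%:E < +oo)%E.
  move=> t0 mA At; apply: le_lt_trans (hoo t0); rewrite primitiveH//.
  apply: ge0_subset_integral => //; first exact: measurable_half_line.
  - by apply/measurable_EFinP; exact: mH.
  - by move=> x _; rewrite lee_fin.
have intH (A : set R) : measurable A -> (\int[mu]_(x in A) (H x)%:E < +oo)%E ->
    mu.-integrable A (EFin \o H).
  move=> mA Aoo; apply/integrableP; split; first by apply/measurable_EFinP; exact: mH.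
  by under eq_integral do rewrite /= ger0_norm//.
have [bE|bE] : b = true \/ b = false by case: (b); [left|right].
- have Fb t : 0 < t -> fine (primitive b h t) = parameterized_integral mu 0 t H.
    move=> t0; rewrite primitiveH// /parameterized_integral /Rintegral /half_line bE.
    rewrite -[in RHS]integral_itv_obnd_cbnd; last by apply/measurable_EFinP; exact: mH.
    by rewrite integral_itv_bndo_bndc//; apply/measurable_EFinP; exact: mH.
  have i0T : mu.-integrable `[0, T] (EFin \o H).
    apply: intH => //; rewrite integral_itv_bndoo; last by apply/measurable_EFinP; exact: mH.
    by apply: (finH _ T) => //; rewrite /half_line bE.
  have c0T := parameterized_integral_continuous (ltW T0) i0T.
  have F0 : parameterized_integral mu 0 0 H = 0.
    by rewrite /parameterized_integral set_itv1 Rintegral_set1.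
  have [|s] := @IVT _ _ 0 T c (ltW T0) c0T.
    by rewrite F0 -Fb// min_l ?max_r ?ltW// (lt_trans c0).
  rewrite in_itv/= => /andP[s0 sT] sc.
  have {}s0 : 0 < s.
    by rewrite lt_neqAle s0 andbT; apply/eqP => s0E; rewrite -s0E F0 in sc; rewrite sc ltxx in c0.
  by exists s => //; rewrite Fb.
- have ET t : half_line b t = `]t, +oo[%classic by rewrite /half_line bE.
  have iT K : mu.-integrable `[T, K] (EFin \o H).
    apply: intH => //; rewrite integral_itv_bndoo; last by apply/measurable_EFinP; exact: mH.
    apply: (finH _ T) => //; rewrite ET => x /=; rewrite !in_itv/= andbT.
    by move=> /andP[].
  pose I x := parameterized_integral mu T x H.
  have IE x : (I x)%:E = (\int[mu]_(z in `]T, x]) (H z)%:E)%E.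
    rewrite /I /parameterized_integral /Rintegral fineK; last exact: integrable_fin_num (iT x).
    by rewrite integral_itv_obnd_cbnd//; apply/measurable_EFinP; exact: mH.
  have [K TK IK] : exists2 K, T < K & fine (primitive b h T) - c < I K.
    have : (\int[mu]_(z in `]T, (T + n%:R)%R]) (H z)%:E)%E @[n --> \oo] -->
        (fine (primitive b h T))%:E.
      rewrite -primitiveE// primitiveH// ET (itv_bndy_bigcup_BRight _ T).
      apply: ge0_nondecreasing_set_cvg_integral => //.
      - apply/nondecreasing_seqP => n; rewrite subsetEset; apply: subset_itvl.
        by rewrite bnd_simp lerD2l ler_nat.
      - by move=> n; apply/measurable_EFinP; exact: mH.
      - by move=> n x _; rewrite lee_fin.
    under eq_fun do rewrite -IE.
    move=> /fine_cvg /= cv.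
    have : \forall n \near \oo, fine (primitive b h T) - c < I (T + n%:R).
      by apply: (cvgr_gt _ cv); rewrite gtrBl.
    move=> [n _ nI]; exists (T + n.+1%:R); first by rewrite ltrDl.
    exact: (nI n.+1 (leqnSn n)).
  have [|s] := @IVT _ _ T K (fine (primitive b h T) - c) (ltW TK)
      (parameterized_integral_continuous (ltW TK) (iT K)).
    have -> : parameterized_integral mu T T H = 0.
      by rewrite /parameterized_integral set_itv1 Rintegral_set1.
    rewrite ge_min le_max (ltW IK) orbT andbT subr_ge0; apply/orP; left; exact: ltW.
  rewrite in_itv/= => /andP[Ts sK] sc.
  have s0 : 0 < s by exact: lt_le_trans Ts.
  exists s => //.
  have : primitive b h T = ((I s)%:E + primitive b h s)%E.
    rewrite IE !primitiveH// !ET (@itv_bndbnd_setU _ _ _ (BRight s)) ?bnd_simp//.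
    rewrite integral_setU//.
    - by apply/measurable_EFinP; exact: mH.
    - apply/disj_set2P; rewrite -subset0 => z/=; rewrite !in_itv/= => -[/andP[_]].
      by rewrite leNgt => /negbTE ->.
  rewrite (primitiveE T0) (primitiveE s0) -EFinD => /eqP; rewrite eqe => /eqP.
  by rewrite /I sc => e; lra.
Qed.

End primitive_theory.

Lemma Lnorm_on0 q (E : set R) : (0 < q)%E -> Lnorm_on q E (fun=> 0) = 0%E.
Proof.
move=> q0; rewrite -[RHS](@Lnorm0 _ _ _ mu q) ?gt_eqF//; apply: eq_Lnorm => x.
by rewrite patchE; case: ifPn.
Qed.

Section hardy_inequality.
Variables (b : bool) (p q : \bar R) (U V h : R -> R) (B : R).
Hypotheses (p1 : (1 <= p)%E) (pq : (p <= q)%E) (B0 : 0 <= B).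
Hypotheses (mU : measurable_fun (Rplus R) U) (mV : measurable_fun (Rplus R) V).
Hypothesis mh : measurable_fun (Rplus R) h.
Hypotheses (U0 : forall x, 0 < x -> 0 < U x) (V0 : forall x, 0 < x -> 0 < V x).
Hypothesis h0 : forall x, 0 < x -> 0 <= h x.
Hypothesis UVB : forall t, 0 < t ->
  (Lnorm_on q (half_line b t^-1%R) U *
   Lnorm_on (hoelder_conjugate p) (half_line b t) (fun x => (V x)^-1%R) <= B%:E)%E.
Hypothesis Vhoo : (Lnorm_on p (Rplus R) (fun x => (V x * h x)%R) < +oo)%E.

Let p0 : (0 < p)%E. Proof. exact: lt_le_trans p1. Qed.
Let q1 : (1 <= q)%E. Proof. exact: le_trans pq. Qed.
Let q0 : (0 < q)%E. Proof. exact: lt_le_trans q1. Qed.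
Let p'0 : (0 < hoelder_conjugate p)%E.
Proof. by apply: lt_le_trans (hoelder_conj_ge1 p1). Qed.

Let mVh : measurable_fun (Rplus R) (fun x => (V x * h x)%R).
Proof. exact: measurable_funM. Qed.

Let mVi : measurable_fun (Rplus R) (fun x => (V x)^-1%R).
Proof. exact: measurable_inv_pos. Qed.

Let sub_measurable t (f : R -> R) : 0 < t ->
  measurable_fun (Rplus R) f -> measurable_fun (half_line b t) f.
Proof. by move=> t0; apply: measurable_funS; [exact: measurable_itv|exact: half_line_gt0]. Qed.

(* Hölder's inequality for h = (V h) (1/V), enlarging the domain of 1/V *)
Let integral_piece (A : set R) t : 0 < t -> measurable A -> A `<=` half_line b t ->
  (\int[mu]_(x in A) (h x)%:E <= Lnorm_on p A (fun x => (V x * h x)%R) *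
    Lnorm_on (hoelder_conjugate p) (half_line b t) (fun x => (V x)^-1%R))%E.
Proof.
move=> t0 mA At; have AP : A `<=` Rplus R by move=> x /At; exact: half_line_gt0.
have gt0 x : A x -> 0 < x by move=> /AP; rewrite /= in_itv/= andbT.
have mS (f : R -> R) : measurable_fun (Rplus R) f -> measurable_fun A f.
  by apply: measurable_funS => //; exact: measurable_itv.
have := hoelder_on p1 mA (mS _ mVh) (mS _ mVi) => H.
apply: le_trans (le_trans H _); last first.
  by apply: lee_wpmul2l; [exact: Lnorm_on_ge0|exact: le_Lnorm_on].
rewrite [leLHS]integral_mkcond [leRHS]integral_mkcond.
apply: ge0_le_integralT => x; rewrite !patchE; case: ifPn => //.
  by rewrite inE => /gt0 x0; rewrite lee_fin h0.
rewrite inE => /gt0 x0; rewrite lee_fin mulrAC divff ?mul1r ?gt_eqF ?V0//.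
exact: ler_norm.
Qed.

(** The norm of U over a half line is positive, so the condition makes the norm
    of 1/V over the half line at t finite. *)
Lemma primitive_lty t : 0 < t -> (primitive b h t < +oo)%E.
Proof.
move=> t0; apply: le_lt_trans (integral_piece t0 (measurable_half_line b t) (@subset_refl _ _)) _.
set W := Lnorm_on (hoelder_conjugate p) _ _.
have W0 : (0 <= W)%E by exact: Lnorm_on_ge0.
have Woo : (W < +oo)%E.
  rewrite ltey; apply/negP => /eqP Wy; have := UVB t0; rewrite -/W Wy gt0_muley ?leye_eq//.
  apply: Lnorm_on_gt0 => //; first exact: measurable_half_line.
  - by apply: half_line_measure_gt0; rewrite invr_gt0.
  - by apply: sub_measurable => //; rewrite invr_gt0.
  - move=> x /(half_line_gt0 _); rewrite invr_gt0 => /(_ t0) /=.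
    by rewrite in_itv/= andbT; exact: U0.
apply: lte_mul_pinfty => //; first exact: Lnorm_on_ge0.
rewrite ge0_fin_numE ?Lnorm_on_ge0//; apply: le_lt_trans Vhoo.
by apply: le_Lnorm_on => //; exact: half_line_gt0.
Qed.

(** Let F be the primitive of h, M = F T, and let t_k be points where F equals
    M / 2^(k+1). These cut the half line with endpoint T into blocks: where
    F (1/y) lies between M / 2^(k+1) and M / 2^k, it is at most 4 times the
    integral M / 2^(k+2) of h over the block between t_k and t_(k+1). Hölder's
    inequality on that block and the condition at t_k bound the norm of
    U F(1/y) over the k-th range of y by 4 B times the norm of V h over the
    k-th block. Blocks being disjoint, these bounds add up since p <= q.
    Finally T exhausts the half line. *)
Lemma hardy_inequality :
  (Lnorm_on q (Rplus R) (fun y => (U y * fine (primitive b h y^-1))%R) <=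
   (4 * B)%:E * Lnorm_on p (Rplus R) (fun x => (V x * h x)%R))%E.
Proof.
pose F t := fine (primitive b h t).
have FE t : 0 < t -> primitive b h t = (F t)%:E by exact: (primitiveE h0 primitive_lty).
have F0 t : 0 < t -> 0 <= F t by move=> t0; rewrite -lee_fin -FE// primitive_ge0.
have Fle s t : 0 < s -> 0 < t -> half_line b s `<=` half_line b t -> F s <= F t.
  exact: (fine_primitive_le mh h0 primitive_lty).
have Flt s t : 0 < s -> 0 < t -> F s < F t -> half_line b t s.
  move=> s0 t0 st; have [ts|//] := @half_line_total _ b t s s0.
  by have := Fle _ _ t0 s0 ts; rewrite leNgt st.
set N := Lnorm_on p _ _.
pose f y := U y * F y^-1.
have mf : measurable_fun (Rplus R) f.
  by apply: measurable_funM => //; exact: (measurable_primitive_inv mh h0 primitive_lty).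
have step T : 0 < T -> (Lnorm_on q (Rplus R `\` half_line b T^-1%R) f <= (4 * B)%:E * N)%E.
  move=> T0; pose M := F T.
  set S := Rplus R `\` half_line b T^-1.
  have mS : measurable S by apply: measurableD; [exact: measurable_itv|exact: measurable_half_line].
  have SP y : S y -> 0 < y /\ half_line b y^-1 `<=` half_line b T.
    move=> [] /=; rewrite in_itv/= andbT => y0 nE; split => //.
    have [//|] := @half_line_total _ b y^-1 T T0.
    by rewrite half_line_inv// => /nE.
  have FM y : S y -> F y^-1 <= M.
    by move=> /SP[y0 yT]; apply: Fle; rewrite ?invr_gt0.
  have [M0|M0] := leP M 0.
    apply: (@le_trans _ _ 0%E); last first.
      by rewrite mule_ge0 ?Lnorm_on_ge0// lee_fin mulr_ge0.
    rewrite -(Lnorm_on0 S q0); apply: le_Lnorm_on => // y Sy.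
    have [y0 _] := SP _ Sy; have y'0 : 0 < y^-1 by rewrite invr_gt0.
    have Fy0 : F y^-1 = 0 by apply/eqP; rewrite eq_le F0// (le_trans (FM _ Sy)).
    by rewrite /f Fy0 mulr0 normr0.
  (* the level 2^(k+1), rather than 2^k, keeps the value below M = F T *)
  have /choice[t tP] : forall k : nat, exists s, 0 < s /\ F s = M / 2 ^+ k.+1.
    move=> k; have [|s s0 sM] := primitive_surj mh h0 primitive_lty T0 (c := M / 2 ^+ k.+1).
      rewrite divr_gt0 ?exprn_gt0//= ltr_pdivrMr ?exprn_gt0// ltr_pMr//.
      by rewrite exprn_egt1// ltr1n.
    by exists s.
  have t0 k : 0 < t k by have [] := tP k.
  have tM k : F (t k) = M / 2 ^+ k.+1 by have [] := tP k.
  have tt k : half_line b (t k) (t k.+1).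
    apply: Flt => //; rewrite !tM ltr_pM2l// ltf_pV2 ?posrE ?exprn_gt0//.
    by rewrite ltr_eXn2l// ltr1n.
  have Ett j k : (j <= k)%N -> half_line b (t k) `<=` half_line b (t j).
    elim: k => [|k IH]; first by rewrite leqn0 => /eqP->.
    rewrite leq_eqVlt => /predU1P[->//|/IH]; apply: subset_trans.
    exact: half_line_sub.
  (* outside D k one has F (1/y) <= M / 2^(k+1), so if k is the first index with
     y in D k, then F (1/y) <= M / 2^k *)
  pose D k := half_line b (t k)^-1%R.
  have mD k : measurable (D k) by exact: measurable_half_line.
  pose Y k := seqDU D k `&` S.
  pose X k := half_line b (t k) `\` half_line b (t k.+1).
  have mX k : measurable (X k) by apply: measurableD; exact: measurable_half_line.
  have XE k : X k `<=` half_line b (t k) by move=> x [].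
  have XP : \bigcup_k X k `<=` Rplus R by move=> x [k _ /XE]; exact: half_line_gt0.
  have mY k : measurable (Y k).
    by apply: measurableI => //; apply: measurableD => //; exact: bigsetU_measurable.
  have YP : \bigcup_k Y k `<=` Rplus R.
    by move=> y [k _ [_ /SP[y0 _]]]; rewrite /= in_itv/= andbT.
  have YF k y : Y k y -> F y^-1 <= M / 2 ^+ k.
    case: k => [|k] [[Dy nD] Sy]; first by rewrite expr0 divr1 FM.
    have [y0 _] := SP _ Sy; have y'0 : 0 < y^-1 by rewrite invr_gt0.
    rewrite -tM; apply: Fle => //.
    have [//|] := @half_line_total _ b y^-1 (t k) (t0 k).
    by rewrite half_line_inv// => Dk; exfalso; apply: nD; rewrite big_ord_recr/=; right.
  have intX k : (\int[mu]_(x in X k) (h x)%:E)%E = (M / 2 ^+ k / 4)%:E.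
    have : primitive b h (t k) =
        (primitive b h (t k.+1) + \int[mu]_(x in X k) (h x)%:E)%E.
      have XU : half_line b (t k.+1) `|` X k = half_line b (t k).
        by rewrite /X setDUK//; exact: half_line_sub.
      rewrite /primitive -[in LHS]XU; apply: integral_setU => //.
      - exact: measurable_half_line.
      - exact: mX.
      - by rewrite XU; apply/measurable_EFinP; exact: sub_measurable.
      - by apply/disj_set2P; rewrite -subset0 => x [? [_]].
    rewrite !FE// !tM; case: (integral _ _ _) => [i|//|//].
    rewrite -EFinD => /eqP; rewrite eqe => /eqP e; congr (_%:E).
    have -> : i = M / 2 ^+ k.+1 - M / 2 ^+ k.+2 by rewrite e; ring.
    by rewrite !exprS; field; rewrite expf_neq0.
  apply: (@le_trans _ _ (Lnorm_on q (\bigcup_k Y k) f)).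
    apply: le_Lnorm => // y; rewrite !patchE.
    case: ifPn => [|_]; last by rewrite abse0 abse_ge0.
    rewrite inE => Sy; have [y0 _] := SP _ Sy; have y'0 : 0 < y^-1 by rewrite invr_gt0.
    have := F0 _ y'0; rewrite le_eqVlt => /predU1P[Fy|Fy].
      by rewrite /= /f -Fy mulr0 normr0 abse_ge0.
    rewrite mem_set//.
    have [k kF] : exists k : nat, M / 2 ^+ k.+1 < F y^-1.
      exists (Num.trunc (M / F y^-1)); rewrite ltr_pdivrMr ?exprn_gt0// mulrC -ltr_pdivrMr//.
      apply: lt_le_trans (truncnS_gt _) _.
      by rewrite -natrX ler_nat ltnW// ltn_expl.
    have : (\bigcup_k D k) y.
      by exists k => //; rewrite /D -half_line_inv//; apply: Flt => //; rewrite tM.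
    by rewrite seqDU_bigcup_eq => -[j _ Dj]; exists j.
  apply: (@le_trans _ _ ((4 * B)%:E * Lnorm_on p (\bigcup_k X k) (fun x => (V x * h x)%R))%E); last first.
    by rewrite lee_wpmul2l ?lee_fin ?mulr_ge0//; exact: le_Lnorm_on.
  apply: trivIset_Lnorm_on_le => //.
  - by rewrite mulr_ge0.
  - exact/trivIset_setIr/trivIset_seqDU.
  - apply: ltn_trivIset => n m mn; rewrite -subset0 => x [[_ xm] [xn _]].
    by apply: xm; exact: Ett xn.
  - by apply: measurable_funS mf => //; exact: measurable_itv.
  - by apply: measurable_funS mVh => //; exact: measurable_itv.
  - move=> k; set c := M / 2 ^+ k in intX YF *.
    have c0 : 0 <= c by rewrite divr_ge0// ?exprn_ge0// ltW.
    apply: (@le_trans _ _ (Lnorm_on q (D k) (fun y => (c * U y)%R))).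
      apply: le_Lnorm_on => //; first by move=> y [[]].
      move=> y Yy; have [_ /SP[y0 _]] := Yy; have y'0 : 0 < y^-1 by rewrite invr_gt0.
      by rewrite /f !normrM mulrC ler_wpM2r// !ger0_norm ?F0// YF.
    have Dk0 : 0 < (t k)^-1 by rewrite invr_gt0.
    rewrite Lnorm_onZl//; last exact: sub_measurable.
    have := integral_piece (t0 k) (mX k) (@XE k); rewrite intX -/c.
    have := UVB (t0 k); rewrite -/(D k).
    set u := Lnorm_on q _ _; set w := Lnorm_on (hoelder_conjugate p) _ _.
    set z := Lnorm_on p _ _ => uw cz.
    have -> : c%:E = (4%:E * (c / 4)%:E)%E by rewrite -EFinM; congr (_%:E); field.
    rewrite (EFinM 4 B) -!muleA lee_pmul2l//.
    apply: (@le_trans _ _ (z * w * u)%E); first by rewrite lee_wpmul2r ?Lnorm_on_ge0.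
    by rewrite -muleA muleC lee_wpmul2r ?Lnorm_on_ge0// muleC.
  - by apply: le_lt_trans Vhoo; exact: le_Lnorm_on.
(* the estimate is uniform in T; T runs through the points exhaust b n *)
have PE : \bigcup_n (Rplus R `\` half_line b (exhaust b n)^-1) = Rplus R.
  apply/seteqP; split => [y [n _ []]//|y Py]; have y0 : 0 < y by move: Py; rewrite /= in_itv/= andbT.
  have y'0 : 0 < y^-1 by rewrite invr_gt0.
  have [n yn] := @exhaustP _ b y^-1 y'0; exists n => //; split => //.
  rewrite -half_line_inv// ?exhaust_gt0// => /yn; exact: half_line_irr.
rewrite -PE; apply: Lnorm_on_bigcup_le => //.
- by move=> n; apply: measurableD; [exact: measurable_itv|exact: measurable_half_line].
- move=> n m nm; apply/subsetPset => y [Py ny]; split => // my; apply: ny.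
  have y0 : 0 < y by move: Py; rewrite /= in_itv/= andbT.
  move: my; rewrite -half_line_inv ?exhaust_gt0// => my.
  rewrite -half_line_inv ?exhaust_gt0//.
  exact: exhaust_before my.
- by rewrite PE.
- by move=> n; apply: step; exact: exhaust_gt0.
Qed.

End hardy_inequality.
End hardy.

(** * Calculus on powers and the Gamma function *)

Section calculus.
Context {R : realType}.
Local Notation mu := (@lebesgue_measure R).
Implicit Types (f F : R -> R) (a b x s : R).

Lemma within_continuousM (A : set R) f F :
  {within A, continuous f} -> {within A, continuous F} ->
  {within A, continuous (fun x => f x * F x)}.
Proof.
move=> cf cF; apply/subspace_continuousP => x Ax; apply: cvgM.
  by move/subspace_continuousP : cf; exact.
by move/subspace_continuousP : cF; exact.
Qed.

Lemma within_continuousB (A : set R) f F :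
  {within A, continuous f} -> {within A, continuous F} ->
  {within A, continuous (fun x => f x - F x)}.
Proof.
move=> cf cF; apply/subspace_continuousP => x Ax; apply: cvgB.
  by move/subspace_continuousP : cf; exact.
by move/subspace_continuousP : cF; exact.
Qed.

Lemma FTC2_within f F a b : a < b ->
  {within `[a, b], continuous f} -> {within `[a, b], continuous F} ->
  (forall x, a < x < b -> is_derive x 1 F (f x)) ->
  (\int[mu]_(x in `[a, b]) (f x)%:E = (F b - F a)%:E)%E.
Proof.
move=> ab cf cF dF; rewrite EFinB; apply: continuous_FTC2 => //.
- have [_ Fa Fb] := (continuous_within_itvP F ab).1 cF.
  split => // x; by rewrite in_itv/= => /dF[].
- move=> x; by rewrite in_itv/= => /dF[_ <-]; rewrite derive1E.
Qed.

Lemma continuous_powR_gt0 s x : 0 < x -> {for x, continuous (fun t => t `^ s)}.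
Proof.
move=> x0; apply: differentiable_continuous; apply/derivable1_diffP.
by apply: derivable_powR; rewrite in_itv/= x0.
Qed.

Lemma continuous_powR_ge0 s : 0 < s ->
  {within `[0, +oo[, continuous (fun t : R => t `^ s)}.
Proof.
move=> s0; apply/continuous_within_itvcyP; split.
  move=> x; rewrite in_itv/= andbT; exact: continuous_powR_gt0.
by rewrite powR0 ?gt_eqF//; exact: powR_cvg0.
Qed.

(** The s-th power of the inequality u <= exp u at u = x / (2 s). *)
Lemma powR_le_expR s x : 0 < s -> 0 < x ->
  x `^ s <= (2 * s) `^ s * expR (- (2^-1 * - x)).
Proof.
move=> s0 x0; have s2 : 0 < 2 * s by rewrite mulr_gt0.
have -> : expR (- (2^-1 * - x)) = expR (x / (2 * s)) `^ s.
  by rewrite -expRM; congr expR; field; rewrite gt_eqF.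
rewrite -powRM ?expR_ge0 ?(ltW s2)//.
rewrite ge0_ler_powR ?nnegrE ?mulr_ge0 ?expR_ge0 ?(ltW s0) ?(ltW x0)//.
rewrite -ler_pdivrMl// mulrC; apply: le_trans (expR_ge1Dx _).
by rewrite lerDr.
Qed.

Lemma powR_expR_le s x : 0 < s -> 0 < x ->
  x `^ s * expR (- x) <= (2 * s) `^ s * expR (- (2^-1 * x)).
Proof.
move=> s0 x0; apply: le_trans (ler_wpM2r (expR_ge0 _) (powR_le_expR s0 x0)) _.
rewrite -mulrA -expRD le_eqVlt; apply/orP; left; apply/eqP.
by congr (_ * expR _); field.
Qed.
End calculus.

Section Gamma_function.
Context {R : realType}.
Local Notation mu := (@lebesgue_measure R).
Implicit Types (s t : R).

Lemma Gamma_integrable s : 1 < s ->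
  mu.-integrable (Rplus R) (fun t => (t `^ (s - 1) * expR (- t))%:E).
Proof.
move=> s1; have s0 : 0 < s - 1 by rewrite subr_gt0.
pose K := (2 * (s - 1)) `^ (s - 1).
refine (@le_integrable _ _ R mu (Rplus R) (measurable_itv _) (fun t => (t `^ (s - 1) * expR (- t))%:E)
    (fun t => (2 * K)%:E * (exponential_pdf 2^-1 t)%:E)%E _ _ _) => //.
- apply/measurable_EFinP; apply: measurable_funM.
    exact: measurable_funTS (measurable_powR _).
  by apply: measurableT_comp => //; exact: measurableT_comp.
- move=> t; rewrite /= in_itv/= andbT => t0.
  rewrite lee_fin !ger0_norm ?mulr_ge0 ?powR_ge0 ?expR_ge0 ?exponential_pdf_ge0//.
  rewrite /exponential_pdf patchE mem_set/= ?in_itv/= ?(ltW t0)//.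
  rewrite mulrACA divff// mul1r mulNr; exact: powR_expR_le.
- refine (@integrableZl _ _ R mu (Rplus R) (measurable_itv _) (2 * K) (EFin \o exponential_pdf 2^-1) _).
  by apply: integrableS (integrable_exponential_pdf _) => //.
Qed.

(** The integrand is at least exp (- 2) on [1, 2]. *)
Lemma Gamma_gt0 s : 1 < s -> 0 < Gamma s.
Proof.
move=> s1; have s0 : 0 < s - 1 by rewrite subr_gt0.
have /integrableP[mG _] := Gamma_integrable s1.
have fG : (\int[mu]_(t in Rplus R) (t `^ (s - 1) * expR (- t))%:E)%E \is a fin_num.
  by apply: integrable_fin_num (Gamma_integrable s1).
rewrite -lte_fin /Gamma /Rintegral fineK//.
apply: (@lt_le_trans _ _ (\int[mu]_(x in `[1%R, 2%R]) (expR (- 2))%:E)%E).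
  have -> : (\int[mu]_(x in `[1%R, 2%R]) (expR (- 2))%:E = (expR (- 2))%:E * mu `[1%R, 2%R])%E.
    by rewrite integral_cst.
  by rewrite lebesgue_measure_itv/= lte_fin ltr1n mule_gt0// ?lte_fin ?expR_gt0// subr_gt0 ltr1n.
apply: (@le_trans _ _ (\int[mu]_(x in `[1%R, 2%R]) (x `^ (s - 1) * expR (- x))%:E)%E).
  have sub : `[1%R, 2%R]%classic `<=` Rplus R.
    by move=> x /=; rewrite !in_itv/= andbT => /andP[x1 _]; rewrite (lt_le_trans ltr01).
  apply: ge0_le_integral => //.
  - by apply: measurable_funS mG.
  - move=> x /=; rewrite in_itv/= => /andP[x1 x2]; rewrite lee_fin.
    rewrite -[leLHS]mul1r ler_pM ?expR_ge0 ?ler_expR ?lerN2//.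
    by rewrite -[leLHS](powRr0 x) ler_powR// ltW.
apply: ge0_subset_integral => //; last first.
- by move=> x /=; rewrite !in_itv/= andbT => /andP[x1 _]; rewrite (lt_le_trans ltr01).
by move=> x _; rewrite lee_fin mulr_ge0 ?powR_ge0 ?expR_ge0.
Qed.

(** The derivative of F t = t^s exp (- t) is the difference of s times the
    integrand of Gamma s and of the integrand of Gamma (s + 1), and F vanishes
    at 0 and at +oo. The derivative changes sign only at s, so the fundamental
    theorem is used on [0, s] and, in its version for functions of constant
    sign, on [s, +oo[. *)
Lemma Gamma_addr1 s : 1 < s -> Gamma (s + 1) = s * Gamma s.
Proof.
move=> s1; have s0 : 0 < s by exact: lt_trans s1.
have s10 : 0 < s - 1 by rewrite subr_gt0.
pose F := fun t : R => t `^ s * expR (- t).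
pose f := fun t : R => s * (t `^ (s - 1) * expR (- t)) - t `^ s * expR (- t).
have fE t : 0 <= t -> f t = (s - t) * (t `^ (s - 1) * expR (- t)).
  by move=> t0; rewrite /f -[X in _ - X * _](mulr_powRB1 t0 s0); ring.
have cexpN : continuous (fun t : R => expR (- t)).
  move=> t; apply: continuous_comp; [exact: opp_continuous|exact: continuous_expR].
have cpow (r : R) (A : set R) : 0 < r -> A `<=` `[0, +oo[ ->
    {within A, continuous (fun t : R => t `^ r * expR (- t))}.
  move=> r0 A0; apply: within_continuousM.
    exact: (continuous_subspaceW A0 (continuous_powR_ge0 r0)).
  exact: continuous_subspaceT.
have cf (A : set R) : A `<=` `[0, +oo[ -> {within A, continuous f}.
  move=> A0; apply: within_continuousB; last exact: cpow.
  apply: within_continuousM; last exact: cpow.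
  by apply: continuous_subspaceT => x; exact: cst_continuous.
have dF t : 0 < t -> is_derive t 1 F (f t).
  move=> t0; rewrite /F.
  have dp := is_derive1_powR s t0.
  have -> : f t = (t `^ s) *: (- expR (- t)) + (expR (- t)) *: (s * t `^ (s - 1)).
    by rewrite /f /GRing.scale /=; ring.
  apply: is_deriveM.
  rewrite -mulrN1; apply: (@is_derive1_comp _ expR (fun t : R => - t)).
have I1 : (\int[mu]_(x in `[0%R, s]) (f x)%:E = (F s)%:E)%E.
  have s0i : `[0, s]%classic `<=` (`[0, +oo[%classic : set R).
    by move=> x /=; rewrite !in_itv/= => /andP[-> _].
  have dF0 x : 0 < x < s -> is_derive x 1 F (f x) by move=> /andP[/dF].
  rewrite (FTC2_within s0 (cf _ s0i) (cpow _ _ s0 s0i) dF0).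
  by rewrite powR0 ?gt_eqF// mul0r subr0.
have ss : `[s, +oo[%classic `<=` (`[0%R, +oo[%classic : set R).
  by move=> x /=; rewrite !in_itv/= !andbT; apply: le_trans; exact: ltW.
have I2 : (\int[mu]_(x in `[s, +oo[) (f x)%:E = (- F s)%:E)%E.
  rewrite (@le0_continuous_FTC2y _ f F s 0)//.
  - by rewrite sub0e.
  - move=> x sx; rewrite fE; last by rewrite (le_trans _ sx)// ltW.
    by rewrite mulr_le0_ge0 ?subr_le0// mulr_ge0 ?powR_ge0 ?expR_ge0.
  - exact: cf.
  - apply: (@squeeze_cvgr _ _ _ _ (cst 0)
      (fun x => (2 * s) `^ s * expR (- (2^-1 * x))) F).
    + near=> x; have x0 : 0 < x by near: x; exact: nbhs_pinfty_gt.
      by rewrite mulr_ge0 ?powR_ge0 ?expR_ge0//= powR_expR_le.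
    + exact: cvg_cst.
    + rewrite -[X in _ --> X](mulr0 ((2 * s) `^ s)); apply: cvgMr.
      have h : 2^-1 * x @[x --> +oo] --> (+oo : set_system R).
        by apply: gt0_cvgMry; rewrite ?invr_gt0//; exact: cvg_id.
      exact: (@cvg_comp _ _ _ (fun x : R => 2^-1 * x) (fun y : R => expR (- y)) _ _ _ h (@cvgr_expR R)).
  - have := cpow s _ s0 ss.
    by move=> /continuous_within_itvcyP[].
  - by move=> x sx; case: (dF _ (lt_trans s0 sx)).
  - move=> x; rewrite in_itv/= andbT => sx; rewrite derive1E.
    by case: (dF _ (lt_trans s0 sx)).
have i1 : mu.-integrable (Rplus R) (EFin \o (fun t => s * (t `^ (s - 1) * expR (- t)))).
  exact: (@integrableZl _ _ R mu (Rplus R) (measurable_itv _) s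
    (EFin \o (fun t => t `^ (s - 1) * expR (- t))) (Gamma_integrable s1)).
have i2 : mu.-integrable (Rplus R) (EFin \o (fun t => t `^ s * expR (- t))).
  have -> : s = s + 1 - 1 by rewrite addrK.
  by apply: Gamma_integrable; rewrite ltrDr.
have mf (A : set R) : measurable_fun A (EFin \o f).
  apply: measurable_funTS; apply/measurable_EFinP.
  have mp (r : R) : measurable_fun [set: R] (fun t : R => t `^ r * expR (- t)).
    apply: measurable_funM; first exact: measurable_powR.
    by apply: measurableT_comp => //; exact: measurableT_comp.
  by apply: measurable_funB => //; exact: measurable_funM.
suff : \int[mu]_(x in Rplus R) f x = 0.
  rewrite RintegralB// RintegralZl//; last exact: Gamma_integrable.
  by move=> /eqP; rewrite subr_eq0 => /eqP; rewrite /Gamma addrK.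
rewrite /Rintegral integral_itv_obnd_cbnd; last exact: mf.
rewrite (@itv_bndbnd_setU _ _ _ (BRight s))// ?bnd_simp//; last exact: ltW.
rewrite integral_setU//=; last 2 first.
- exact: mf.
- apply/disj_set2P; rewrite -subset0 => z/=; rewrite !in_itv/= => -[/andP[_]].
  by rewrite leNgt => /negbTE ->.
rewrite integral_itv_obnd_cbnd; last exact: mf.
by rewrite I1 I2 -EFinD subrr.
Unshelve. all: by end_near.
Qed.
End Gamma_function.

(** * An averaged cosine *)

Section cosine_bounds.
Context {R : realType}.
Implicit Types x y : R.

Lemma one_sub_cos2 y : 1 - cos y = 2 * sin (y / 2) ^+ 2.
Proof.
rewrite {1}[y](_ : _ = (y / 2) *+ 2); last by rewrite -[RHS]mulr_natr divfK.
by rewrite cos_mulr2n sin2cos2; ring.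
Qed.

Lemma normr_sin_le y : `|sin y| <= `|y|.
Proof.
wlog : y / 0 < y.
  move=> H; have [y0|y0|<-] := ltgtP 0 y; [exact: H| |by rewrite sin0 normr0].
  by rewrite -normrN -sinN -(normrN y); apply: H; rewrite oppr_gt0.
move=> y0; have [|c _] := @MVT _ sin cos 0 y y0 (fun x _ => is_derive_sin x).
  by apply: continuous_subspaceT; exact: continuous_sin.
rewrite sin0 !subr0 => ->; rewrite normrM ler_piMl//; exact: cos_max.
Qed.

Lemma one_sub_cos_ge0 y : 0 <= 1 - cos y.
Proof. by rewrite subr_ge0 cos_le1. Qed.

Lemma one_sub_cos_le_sqr y : 1 - cos y <= y ^+ 2.
Proof.
rewrite one_sub_cos2 -(real_normK (num_real (sin _))) -(real_normK (num_real y)).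
apply: (@le_trans _ _ (2 * `|y / 2| ^+ 2)).
  by rewrite ler_pM2l// lerXn2r ?nnegrE// normr_sin_le.
rewrite normrM exprMn (ger0_norm (_ : 0 <= 2^-1))//.
have -> : 2 * (`|y| ^+ 2 * 2^-1 ^+ 2) = `|y| ^+ 2 / 2 by field.
by have := sqr_ge0 `|y|; lra.
Qed.

(** With c = cos y this is the inequality 0 <= 2 (1 - c)^2. *)
Lemma one_sub_cos_double y : 1 - cos (2 * y) <= 4 * (1 - cos y).
Proof.
rewrite mulr_natl cos_mulr2n; have := cos_le1 y; have := cos_geN1 y; nra.
Qed.

Lemma cos_partial_sum_le x (n : nat) : 0 <= x ->
  \sum_(0 <= k < n) x ^+ k.*2 / (k.*2)`!%:R <= expR x.
Proof.
move=> x0; have e0 k : 0 <= x ^+ k / k`!%:R by rewrite divr_ge0 ?exprn_ge0.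
apply: (@le_trans _ _ (series (exp_coeff x) n.*2)).
  elim: n => [|n IH]; first by rewrite /series/= !big_geq.
  rewrite big_nat_recr//= doubleS /series/= !big_nat_recr//= -addrA.
  apply: lerD; [exact: IH|by rewrite lerDl e0].
apply: nondecreasing_cvgn_le; last exact: is_cvg_series_exp_coeff.
by apply/nondecreasing_seqP => m; rewrite /series/= big_nat_recr//= lerDl e0.
Qed.

End cosine_bounds.

Section cosine_transform.
Context {R : realType}.
Local Notation mu := (@lebesgue_measure R).
Implicit Types (g x r : R) (k n : nat).

(** With g = 1/beta these are the beta moments k! / ((beta + 1) ... (beta + k)):
    they are the moments of 1 - r^g for r uniform on [0, 1], and carry, for
    beta = a - 1/2, the factor Gamma (k + a + 3/2) of the Struve series. *)
Definition moment g k : R := \int[mu]_(r in `[0, 1]) (1 - r `^ g) ^+ k.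

(** The substitution s = sqrt (1 - r^g) turns Poisson's integral of the Struve
    function, integrated by parts, into an average over r in [0, 1]; the
    density of s, which may be singular, disappears and every integrand is continuous and
    bounded. *)
Definition cosine_transform g x : R :=
  \int[mu]_(r in `[0, 1]) (1 - cos (x * Num.sqrt (1 - r `^ g))).

Lemma within_continuousX (A : set R) (f : R -> R) n :
  {within A, continuous f} -> {within A, continuous (fun r => f r ^+ n)}.
Proof.
move=> cf; elim: n => [|n IH].
  by apply: continuous_subspaceT => x; exact: cst_continuous.
have -> : (fun r => f r ^+ n.+1) = (fun r => f r * f r ^+ n).
  by apply/funext => r; rewrite exprS.
exact: within_continuousM.
Qed.

Lemma within_continuous_comp (A : set R) (f h : R -> R) : continuous h ->
  {within A, continuous f} -> {within A, continuous (fun r => h (f r))}.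
Proof.
move=> ch cf; apply/subspace_continuousP => x Ax.
apply: (@cvg_comp _ _ _ f h _ (nbhs (f x))); last exact: ch.
by move/subspace_continuousP : cf; exact.
Qed.

Lemma continuous_integrable01 (f : R -> R) :
  {within `[0, 1], continuous f} -> mu.-integrable `[0, 1] (EFin \o f).
Proof. by move=> cf; apply: continuous_compact_integrable => //; exact: segment_compact. Qed.

Lemma one_sub_powR_continuous g : 0 < g ->
  {within `[0, 1], continuous (fun r : R => 1 - r `^ g)}.
Proof.
move=> g0; apply: within_continuousB.
  by apply: continuous_subspaceT => x; exact: cst_continuous.
apply: continuous_subspaceW (continuous_powR_ge0 g0) => x /=.
by rewrite !in_itv/= => /andP[->].
Qed.

Lemma one_sub_powR_itv01 g r : 0 < g -> 0 <= r <= 1 -> 0 <= 1 - r `^ g <= 1.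
Proof.
move=> g0 /andP[r0 r1]; have := powR_ge0 r g; have : r `^ g <= 1.
  apply: (@le_trans _ _ (1 `^ g)); last by rewrite powR1.
  by rewrite ge0_ler_powR ?nnegrE// ltW.
lra.
Qed.

Lemma moment0 g : moment g 0 = 1.
Proof.
rewrite /moment; under eq_Rintegral do rewrite expr0.
by rewrite Rintegral_cst//= lebesgue_measure_itv/= lte_fin ltr01 -EFinB subr0 mul1r.
Qed.

(** Integrate the derivative of r (1 - r^g)^(k+1), which vanishes at 0 and 1. *)
Lemma momentS g k : 0 < g ->
  (1 + k.+1%:R * g) * moment g k.+1 = k.+1%:R * g * moment g k.
Proof.
move=> g0; pose m := fun r : R => 1 - r `^ g.
have cm := one_sub_powR_continuous g0.
have cX n : {within `[0, 1], continuous (fun r => m r ^+ n)} by exact: within_continuousX.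
have cc (c : R) : {within `[0, 1], continuous (fun _ : R => c)}.
  by apply: continuous_subspaceT => x; exact: cst_continuous.
pose f := fun r => (1 + k.+1%:R * g) * m r ^+ k.+1 - (k.+1%:R * g) * m r ^+ k.
pose F := fun r => r * m r ^+ k.+1.
have cf : {within `[0, 1], continuous f}.
  by apply: within_continuousB; apply: within_continuousM.
have cF : {within `[0, 1], continuous F}.
  apply: within_continuousM => //.
  by apply: continuous_subspaceT => x; exact: cvg_id.
have dF r : 0 < r < 1 -> is_derive r 1 F (f r).
  move=> /andP[r0 _].
  have dm : is_derive r 1 m (- (g * r `^ (g - 1))).
    have dp := is_derive1_powR g r0.
    rewrite -sub0r; exact: (is_deriveB (is_derive_cst (1 : R) r 1) dp).
  have dX := @is_deriveX _ _ m k.+1 _ _ _ dm.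
  have dM := is_deriveM (is_derive_id r 1) dX.
  have -> : F = (id * m ^+ k.+1)%R by apply/funext => x; rewrite /F !fctE.
  apply: is_derive_eq.
  rewrite /f /GRing.scale /= !fctE/=.
  have := mulr_powRB1 (ltW r0) g0; rewrite /m exprS => <-; ring.
have := @FTC2_within _ f F 0 1 ltr01 cf cF dF.
have -> : F 1 - F 0 = 0 by rewrite /F /m powR1 subrr expr0n /= mulr0 mul0r subrr.
have i n : mu.-integrable `[0, 1] (EFin \o (fun r => m r ^+ n)).
  exact: continuous_integrable01.
have iz c n : mu.-integrable `[0, 1] (EFin \o (fun r => c * m r ^+ n)).
  by apply: continuous_integrable01; exact: within_continuousM.
move=> /(congr1 fine) /= I0; apply/eqP; rewrite -subr_eq0; apply/eqP.
rewrite -I0 /moment -!RintegralZl//.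
by rewrite -RintegralB.
Qed.

Let phi g r := Num.sqrt (1 - r `^ g).

Lemma phi_continuous g : 0 < g -> {within `[0, 1], continuous (phi g)}.
Proof.
move=> g0; apply: (@within_continuous_comp _ (fun r => 1 - r `^ g) Num.sqrt).
  exact: sqrt_continuous.
exact: one_sub_powR_continuous.
Qed.

Lemma phi_itv01 g r : 0 < g -> 0 <= r <= 1 -> 0 <= phi g r <= 1.
Proof.
move=> g0 /(one_sub_powR_itv01 g0)/andP[m0 m1]; rewrite /phi sqrtr_ge0/=.
by rewrite -[leRHS]sqrtr1 ler_sqrt.
Qed.

Lemma continuous_comp_phi g x (h : R -> R) : 0 < g -> continuous h ->
  {within `[0, 1], continuous (fun r => h (x * phi g r))}.
Proof.
move=> g0 ch; apply: (@within_continuous_comp _ (fun r => x * phi g r) h ch).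
apply: within_continuousM; last exact: phi_continuous.
by apply: continuous_subspaceT => z; exact: cst_continuous.
Qed.

Lemma one_sub_cos_continuous g x : 0 < g ->
  {within `[0, 1], continuous (fun r => 1 - cos (x * phi g r))}.
Proof.
move=> g0; apply: (@continuous_comp_phi g x (fun y => 1 - cos y)) => // y.
by apply: cvgB; [exact: cvg_cst|exact: continuous_cos].
Qed.

Lemma one_sub_cos_integrable g x : 0 < g ->
  mu.-integrable `[0, 1] (EFin \o (fun r => 1 - cos (x * phi g r))).
Proof. by move=> g0; apply/continuous_integrable01/one_sub_cos_continuous. Qed.

(** Termwise integration of the cosine series: its partial sums at y are bounded
    by exp |y|, so dominated convergence applies. The constant term of the
    cosine cancels the 1, hence the shift of the index. *)
Lemma cvg_cosine_transform g x : 0 < g ->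
  \sum_(0 <= k < n) ((-1) ^+ k * x ^+ k.+1.*2 * moment g k.+1 / (k.+1.*2)`!%:R)
    @[n --> \oo] --> cosine_transform g x.
Proof.
move=> g0.
pose P n r := series (cos_coeff' (x * phi g r)) n.
have PE n r : 0 <= r <= 1 -> P n r =
    \sum_(0 <= k < n) ((-1) ^+ k * x ^+ k.*2 / (k.*2)`!%:R * (1 - r `^ g) ^+ k).
  move=> /(one_sub_powR_itv01 g0)/andP[m0 m1]; rewrite /P /series/=.
  apply: eq_bigr => k _; rewrite /cos_coeff' exprMn.
  have -> : phi g r ^+ k.*2 = (1 - r `^ g) ^+ k.
    by rewrite -muln2 mulnC exprM sqr_sqrtr.
  by rewrite -exprnP; ring.
pose cf k : R := (-1) ^+ k * x ^+ k.*2 / (k.*2)`!%:R.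
have icf k : mu.-integrable `[0, 1] (EFin \o (fun r => cf k * (1 - r `^ g) ^+ k)).
  apply: continuous_integrable01; apply: within_continuousM.
    by apply: continuous_subspaceT => z; exact: cst_continuous.
  by apply: within_continuousX; exact: one_sub_powR_continuous.
have cP n : {within `[0, 1], continuous (P n)}.
  apply: (@continuous_comp_phi g x (fun y => series (cos_coeff' y) n)) => //.
  elim: n => [|n IH] y; first by rewrite /series/=; under eq_fun do rewrite big_geq//; exact: cvg_cst.
  rewrite /series/=; under eq_fun do rewrite big_nat_recr//=.
  apply: cvgD; first exact: IH.
  rewrite /cos_coeff'; apply: cvgMl; apply: cvgMr; exact: exprn_continuous.
have intP n : (\int[mu]_(r in `[0%R, 1%R]) (P n r)%:E)%E =
    (\sum_(0 <= k < n) cf k * moment g k)%:E.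
  transitivity (\int[mu]_(r in `[0%R, 1%R])
      \sum_(k <- index_iota 0 n) (cf k * (1 - r `^ g) ^+ k)%:E)%E.
    apply: eq_integral => r; rewrite inE/= in_itv/= => /PE->.
    by rewrite sumEFin.
  rewrite integral_sum// -sumEFin; apply: eq_bigr => k _.
  have iX : mu.-integrable `[0, 1] (EFin \o (fun r => (1 - r `^ g) ^+ k)).
    by apply: continuous_integrable01; apply: within_continuousX; exact: one_sub_powR_continuous.
  rewrite /moment -RintegralZl// /Rintegral fineK//.
  exact: (integrable_fin_num _ (icf k)).
have : (\int[mu]_(r in `[0%R, 1%R]) (P n r)%:E)%E @[n --> \oo] -->
       (\int[mu]_(r in `[0%R, 1%R]) (cos (x * phi g r))%:E)%E.
  apply: (@dominated_cvg _ _ _ _ _ _ _ _ (fun=> (expR `|x|)%:E)) => //.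
  - move=> n; apply/measurable_EFinP; apply: subspace_continuous_measurable_fun => //.
    exact: cP.
  - move=> r r01; apply: cvg_EFin; first exact: nearW.
    exact: cvg_cos_coeff'.
  - by apply: continuous_integrable01; apply: continuous_subspaceT => z; exact: cst_continuous.
  - move=> n r /=; rewrite in_itv/= => /(phi_itv01 g0)/andP[p0 p1]; rewrite lee_fin.
    apply: le_trans (cos_partial_sum_le n (normr_ge0 x)).
    apply: le_trans (ler_norm_sum _ _ _) _; apply: ler_sum => k _.
    have f0 : 0 <= (k.*2)`!%:R^-1 :> R by rewrite invr_ge0.
    rewrite /cos_coeff' -exprnP normrM (ger0_norm f0) ler_wpM2r// normrM normrX normrN1.
    rewrite expr1n mul1r normrX lerXn2r ?nnegrE// normrM ler_piMr// ger0_norm//.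
have icos : mu.-integrable `[0, 1] (EFin \o (fun r => cos (x * phi g r))).
  by apply/continuous_integrable01/continuous_comp_phi => //; exact: continuous_cos.
have -> : (\int[mu]_(r in `[0%R, 1%R]) (cos (x * phi g r))%:E)%E =
    (\int[mu]_(r in `[0, 1]) cos (x * phi g r))%:E.
  by rewrite /Rintegral fineK//; exact: (integrable_fin_num _ icos).
under eq_fun do rewrite intP.
move=> /fine_cvg; rewrite -cvg_shiftS => lim.
have -> : cosine_transform g x = 1 - \int[mu]_(r in `[0, 1]) cos (x * phi g r).
  rewrite /cosine_transform RintegralB//.
    congr (_ - _).
    by rewrite Rintegral_cst//= lebesgue_measure_itv/= lte_fin ltr01 -EFinB subr0 mul1r.
  by apply: continuous_integrable01; apply: continuous_subspaceT => z; exact: cst_continuous.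
have : 1 - \sum_(0 <= k < n.+1) cf k * moment g k @[n --> \oo] -->
    1 - \int[mu]_(r in `[0, 1]) cos (x * phi g r).
  by apply: cvgB; [exact: cvg_cst|exact: lim].
apply: cvg_trans; apply: near_eq_cvg; apply: nearW => n.
rewrite big_nat_recl// /cf moment0 expr0 fact0 divr1 !mulr1 opprD addrA subrr sub0r.
rewrite -sumrN; apply: eq_bigr => k _; rewrite exprS; ring.
Qed.

Lemma cosine_transform_le2 g x : 0 < g -> cosine_transform g x <= 2.
Proof.
move=> g0; apply: (@le_trans _ _ (\int[mu]_(r in `[0, 1]) 2)); last first.
  by rewrite Rintegral_cst//= lebesgue_measure_itv/= lte_fin ltr01 -EFinB subr0 mulr1.
apply: le_Rintegral => //.
- exact: one_sub_cos_integrable.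
- by apply: continuous_integrable01; apply: continuous_subspaceT => z; exact: cst_continuous.
- by move=> r _; have := cos_geN1 (x * Num.sqrt (1 - r `^ g)); lra.
Qed.

Lemma cosine_transform_le_sqr g x : 0 < g -> cosine_transform g x <= x ^+ 2.
Proof.
move=> g0; apply: (@le_trans _ _ (\int[mu]_(r in `[0, 1]) (x ^+ 2))); last first.
  by rewrite Rintegral_cst//= lebesgue_measure_itv/= lte_fin ltr01 -EFinB subr0 mulr1.
apply: le_Rintegral => //.
- exact: one_sub_cos_integrable.
- by apply: continuous_integrable01; apply: continuous_subspaceT => z; exact: cst_continuous.
- move=> r /=; rewrite in_itv/= => /(phi_itv01 g0)/andP[p0 p1].
  apply: le_trans (one_sub_cos_le_sqr _) _; rewrite -/(phi g r) exprMn ler_piMr ?sqr_ge0//.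
  by rewrite expr_le1.
Qed.

Lemma cosine_transform_double g x : 0 < g ->
  cosine_transform g (2 * x) <= 4 * cosine_transform g x.
Proof.
move=> g0; rewrite /cosine_transform -RintegralZl//; last exact: one_sub_cos_integrable.
apply: le_Rintegral => //.
- exact: one_sub_cos_integrable.
- apply: continuous_integrable01; apply: within_continuousM; last exact: one_sub_cos_continuous.
  by apply: continuous_subspaceT => z; exact: cst_continuous.
- by move=> r _; rewrite -mulrA; exact: one_sub_cos_double.
Qed.

(** The integrand is not pointwise bounded below, but its oscillation averages
    out. Let h be minus the derivative of phi r = sqrt (1 - r^g), so that
    0 <= h <= L on [1/4, 3/4], an interval avoiding the singularities of h at
    0 and 1. Then (1 - cos (x phi)) h has the primitive
    sin (x phi) / x - phi, whose increment is at least
    phi (1/4) - phi (3/4) - 2 / x, and dividing by L gives the bound. *)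
Lemma cosine_transform_large g : 0 < g ->
  exists c X : R, [/\ 0 < c, 0 < X & forall x, X <= x -> c <= cosine_transform g x].
Proof.
move=> g0; pose a : R := 4^-1; pose b : R := 3 / 4.
have ab : a < b by rewrite /a /b; lra.
have b0 : 0 <= b by rewrite /b; lra.
have powlt r s : 0 <= r -> r < s -> r `^ g < s `^ g.
  by move=> r0 rs; rewrite gt0_ltr_powR// nnegrE// (le_trans r0)// ltW.
have ab01 : `[a, b]%classic `<=` (`[0, 1]%classic : set R).
  by move=> r /=; rewrite !in_itv/= /a /b => /andP[? ?]; apply/andP; split; lra.
have m0 r : a <= r <= b -> 0 < 1 - r `^ g.
  move=> /andP[ra rb]; rewrite subr_gt0 -[ltRHS](_ : 1 `^ g = 1); last by rewrite powR1.
  by apply: powlt; move: ra rb; rewrite /a /b; lra.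
have aab : a <= a <= b by rewrite lexx ltW.
have bab : a <= b <= b by rewrite lexx ltW.
have phib : 0 < phi g b by rewrite sqrtr_gt0 m0.
pose del := phi g a - phi g b.
have del0 : 0 < del.
  rewrite subr_gt0 ltr_sqrt ?m0//.
  by rewrite ltrD2l ltrN2; apply: powlt => //; rewrite /a; lra.
pose L := 2 * g / phi g b.
have L0 : 0 < L by rewrite /L divr_gt0// mulr_gt0.
pose h r := g * r `^ (g - 1) / (2 * phi g r).
have hL r : a <= r <= b -> 0 <= h r <= L.
  move=> rab; have /andP[ra rb] := rab.
  have r0 : 0 < r by move: ra; rewrite /a; lra.
  have pr : phi g b <= phi g r.
    rewrite ler_sqrt ?(ltW (m0 _ rab))//.
    by rewrite lerD2l lerN2 ge0_ler_powR ?nnegrE ?(ltW g0) ?(ltW r0) ?b0.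
  have pr0 : 0 < phi g r by exact: lt_le_trans pr.
  (* this holds also for g < 1, since r times it is r^g <= 1 and 1/4 <= r *)
  have r4 : r `^ (g - 1) <= 4.
    have := mulr_powRB1 (ltW r0) g0; have := m0 _ rab; have := powR_ge0 r (g - 1).
    move: ra; rewrite /a; set w := r `^ (g - 1) => ra w0 h1 h2.
    rewrite -h2 in h1; nra.
  rewrite /h divr_ge0 ?mulr_ge0 ?powR_ge0 ?(ltW g0) ?(ltW pr0)//=.
  rewrite ler_pdivrMr ?mulr_gt0// /L mulrAC ler_pdivlMr//.
  have w0 := powR_ge0 r (g - 1).
  apply: (@le_trans _ _ (g * 4 * phi g r)); last by lra.
  by rewrite ler_pM ?mulr_ge0 ?ler_pM2l ?(ltW g0) ?(ltW phib).
(* for x >= 4 / del the oscillating part 2 / x costs at most half of del *)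
exists (del / (2 * L)), (4 / del); split.
- by rewrite divr_gt0// mulr_gt0.
- by rewrite divr_gt0.
move=> x xX; have x0 : 0 < x by apply: lt_le_trans xX; rewrite divr_gt0.
pose F r := x^-1 * sin (x * phi g r) - phi g r.
pose f r := (1 - cos (x * phi g r)) * h r.
have dF r : a < r < b -> is_derive r 1 F (f r).
  move=> /andP[ra rb]; have r0 : 0 < r by move: ra; rewrite /a; lra.
  have mr : 0 < 1 - r `^ g by rewrite m0// !ltW.
  have dm : is_derive r 1 (fun r => 1 - r `^ g) (- (g * r `^ (g - 1))).
    rewrite -sub0r; exact: (is_deriveB (is_derive_cst (1 : R) r 1) (is_derive1_powR g r0)).
  have dphi : is_derive r 1 (phi g) (- h r).
    have := @is_derive1_comp _ Num.sqrt (fun r => 1 - r `^ g) _ _ _ (is_derive1_sqrt mr) dm.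
    by rewrite mulrC mulNr.
  have dx : is_derive r 1 (fun r => x * phi g r) (x * - h r).
    exact: (is_deriveZ x dphi).
  have ds := @is_derive1_comp _ sin (fun r => x * phi g r) _ _ _ (is_derive_sin (x * phi g r)) dx.
  have dsx := is_deriveZ x^-1 ds.
  have dF := is_deriveB dsx dphi.
  have <- : x^-1 *: (cos (x * phi g r) * (x * - h r)) - - h r = f r.
    by rewrite /GRing.scale/= /f; field; rewrite gt_eqF.
  exact: dF.
have cphi : {within `[a, b], continuous (phi g)}.
  exact: continuous_subspaceW ab01 (phi_continuous g0).
have cF : {within `[a, b], continuous F}.
  apply: within_continuousB => //; apply: within_continuousM.
    by apply: continuous_subspaceT => z; exact: cst_continuous.
  apply: (continuous_subspaceW ab01).
  by apply: continuous_comp_phi => //; exact: continuous_sin.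
have c1 : {within `[a, b], continuous (fun r => 1 - cos (x * phi g r))}.
  by apply: (continuous_subspaceW ab01); exact: one_sub_cos_continuous.
have ch : {within `[a, b], continuous h}.
  apply/subspace_continuousP => r; rewrite /= in_itv/= => rab.
  have r0 : 0 < r by case/andP: rab => + _; rewrite /a; lra.
  have cphir : {for r, continuous (phi g)}.
    apply: (@continuous_comp _ _ _ (fun r => 1 - r `^ g) Num.sqrt).
      by apply: continuousB; [exact: cst_continuous|exact: continuous_powR_gt0].
    exact: sqrt_continuous.
  apply: cvg_within_filter; apply: cvgM.
    by apply: cvgMr; exact: continuous_powR_gt0.
  apply: cvgV; first by rewrite gt_eqF// mulr_gt0// sqrtr_gt0 m0.
  by apply: cvgMr; exact: cphir.
have cf : {within `[a, b], continuous f} by exact: within_continuousM.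
have I := FTC2_within ab cf cF dF.
have Fab : del / 2 <= F b - F a.
  have s1 := sin_le1 (x * phi g a); have s2 := sin_geN1 (x * phi g b).
  have xi0 : 0 < x^-1 by rewrite invr_gt0.
  have xi : x^-1 <= del / 4.
    by rewrite -[leRHS]invf_div lef_pV2// posrE divr_gt0.
  by rewrite /F; move: del0 xi; rewrite /del; nra.
rewrite ler_pdivrMr; last exact: mulr_gt0.
suff : (F b - F a) <= L * cosine_transform g x by lra.
have if1 : mu.-integrable `[0, 1] (EFin \o (fun r => L * (1 - cos (x * phi g r)))).
  apply: continuous_integrable01; apply: within_continuousM; last exact: one_sub_cos_continuous.
  by apply: continuous_subspaceT => z; exact: cst_continuous.
rewrite /cosine_transform -RintegralZl//; last exact: one_sub_cos_integrable.
rewrite -lee_fin /Rintegral fineK; last exact: (integrable_fin_num _ if1).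
rewrite -I [leLHS]integral_mkcond [leRHS]integral_mkcond.
apply: ge0_le_integralT => r; rewrite !patchE.
  case: ifPn => //; rewrite inE /= in_itv/= => /hL/andP[h0 _].
  by rewrite lee_fin mulr_ge0// one_sub_cos_ge0.
case: ifPn => [rab|_]; last first.
  by case: ifPn => // _; rewrite lee_fin mulr_ge0 ?(ltW L0)// one_sub_cos_ge0.
rewrite mem_set; last by apply: ab01; rewrite inE in rab.
move: rab; rewrite inE /= in_itv/= => /hL/andP[_ hr].
by rewrite lee_fin /f mulrC ler_wpM2r// one_sub_cos_ge0.
Qed.

(** For small x the quadratic lower bound is pulled down from the range of large
    x: by the inequality for doubled arguments, the bound c x^2 at 2 x implies
    it at x. This avoids any expansion at the origin. *)
Lemma cosine_transform_lower g : 0 < g -> exists c : R, [/\ 0 < c,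
  forall x, 0 < x -> x <= 1 -> c * x ^+ 2 <= cosine_transform g x &
  forall x, 1 <= x -> c <= cosine_transform g x].
Proof.
move=> g0; have [c0 [X0 [c00 X00 H0]]] := cosine_transform_large g0.
pose X := Num.max 1 X0.
have X1 : 1 <= X by rewrite le_max lexx.
have X20 : 0 < 4 * X ^+ 2 by rewrite mulr_gt0// exprn_gt0// (lt_le_trans ltr01).
pose c := c0 / (4 * X ^+ 2); have c_gt0 : 0 < c by rewrite divr_gt0.
have cc0 : c <= c0.
  rewrite ler_pdivrMr// ler_peMr ?(ltW c00)//.
  have : 1 <= X ^+ 2 by rewrite exprn_ege1.
  lra.
(* n counts the doublings that bring x above X; x <= 2 X limits the overshoot *)
have H n x : 0 < x -> X <= 2 ^+ n * x -> x <= 2 * X -> c * x ^+ 2 <= cosine_transform g x.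
  elim: n x => [|n IH] x x0 Xx xX.
    apply: (@le_trans _ _ c0); last by apply: H0; move: Xx; rewrite mul1r ge_max => /andP[].
    rewrite /c mulrAC ler_pdivrMr// ler_wpM2l ?(ltW c00)//.
    have : x ^+ 2 <= (2 * X) ^+ 2 by rewrite lerXn2r ?nnegrE ?mulr_ge0 ?(ltW x0) ?(le_trans ler01 X1).
    by rewrite exprMn; lra.
  have [Xx'|xX'] := leP X x; first by apply: (IH x) => //; rewrite (le_trans Xx')// ler_peMl ?(ltW x0)// exprn_ege1// ler1n.
  have := IH (2 * x); rewrite mulr_gt0// mulrA -exprSr Xx ler_pM2l// (ltW xX').
  move=> /(_ isT isT isT); have := cosine_transform_double x g0; rewrite exprMn; lra.
exists c; split => // x.
- move=> x0 x1; apply: (H (Num.trunc (X / x)).+1) => //; last by lra.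
  rewrite -ler_pdivrMr//; apply: le_trans (ltW (truncnS_gt _)) _.
  by rewrite -natrX ler_nat ltnW// ltn_expl.
- move=> x1; have [Xx|xX] := leP X x.
    by rewrite (le_trans cc0)// H0// (le_trans _ Xx)// le_max lexx orbT.
  have x0 : 0 < x by rewrite (lt_le_trans ltr01).
  apply: (@le_trans _ _ (c * x ^+ 2)); first by rewrite ler_peMr ?(ltW c_gt0)// exprn_ege1.
  apply: (H (Num.trunc (X / x)).+1) => //; last by lra.
  rewrite -ler_pdivrMr//; apply: le_trans (ltW (truncnS_gt _)) _.
  by rewrite -natrX ler_nat ltnW// ltn_expl.
Qed.

End cosine_transform.

(** * The Struve kernel *)

Section kernel.
Context {R : realType}.
Implicit Types (a x z : R).

(** The orientation also selects the power of the kernel: true is the behaviour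
    at 0, false the one at infinity. *)
Definition kernel_exponent a (b : bool) : R := if b then a + 3 / 2 else a - 1 / 2.

Definition struve_kernel a z : R := Num.sqrt z * struve a z.

(** Both sides satisfy the same recursion in k, by the functional equation of
    Gamma and by that of the moments. It turns the coefficients of the Struve
    series into moments divided by factorials of even numbers. *)
Lemma Gamma_moment a (k : nat) : 1 / 2 < a ->
  Gamma (k%:R + 3 / 2) * Gamma (k%:R + a + 3 / 2) * 4 ^+ k *
    ((2 * a + 1) * moment (a - 1 / 2)^-1 k.+1) =
  (k.+1.*2)`!%:R * (Gamma (3 / 2) * Gamma (a + 3 / 2)).
Proof.
move=> ha; set g := (a - 1 / 2)^-1; have b0 : 0 < a - 1 / 2 by rewrite subr_gt0.
have g0 : 0 < g by rewrite invr_gt0.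
have mS m : (a + 1 / 2 + m%:R) * moment g m.+1 = m.+1%:R * moment g m.
  have := momentS m g0; rewrite /g => e.
  transitivity ((a - 1 / 2) * ((1 + m.+1%:R * (a - 1 / 2)^-1) * moment (a - 1 / 2)^-1 m.+1)).
    by rewrite -(natr1 m); field; apply: lt0r_neq0; lra.
  by rewrite e; field; apply: lt0r_neq0; lra.
have pos1 m : (1 : R) < m%:R + 3 / 2 by have : (0 : R) <= m%:R by []; lra.
have pos2 m : 1 < m%:R + a + 3 / 2 by have : (0 : R) <= m%:R by []; lra.
elim: k => [|k IH].
  have e : (a + 1 / 2) * moment g 1 = 1.
    by have := mS 0%N; rewrite moment0 addr0 mulr1.
  have -> : (2 * a + 1) * moment g 1 = 2 * ((a + 1 / 2) * moment g 1) by field.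
  have -> : (1.*2)`!%:R = 2 :> R by [].
  rewrite e mulr0n !add0r expr0; move: (Gamma _) (Gamma _) => G G'.
  by ring.
have e1 : k.+1%:R + 3 / 2 = (k%:R + 3 / 2) + 1 :> R by rewrite -natr1; ring.
have e2 : k.+1%:R + a + 3 / 2 = (k%:R + a + 3 / 2) + 1 :> R by rewrite -natr1; ring.
rewrite e1 e2 !Gamma_addr1//.
have e3 : (k.+2.*2)`!%:R = (2 * k%:R + 3) * (2 * k%:R + 4) * (k.+1.*2)`!%:R :> R.
  have : (k.+1.*2)%:R = 2 * k%:R + 2 :> R by rewrite -mul2n natrM -natr1; ring.
  have -> : k.+2.*2 = (k.+1.*2).+2 by [].
  by move: (k.+1.*2) => m e; rewrite !factS !natrM -!natr1 e; ring.
rewrite e3 -[RHS]mulrA -IH exprS.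
have e : (k%:R + a + 3 / 2) * moment g k.+2 = (k%:R + 2) * moment g k.+1.
  have -> : k%:R + 2 = k.+2%:R :> R by rewrite -(addn2 k) natrD.
  by rewrite -mS -(addn1 k) natrD; congr (_ * _); field.
set G := Gamma (k%:R + 3 / 2 : R); set G' := Gamma (_ + a + _); set p := (4 : R) ^+ k.
move: G G' p (moment g k.+2) (moment g k.+1) e => G G' p M M' e.
transitivity (4 * (k%:R + 3 / 2) * G * G' * p * (2 * a + 1) * ((k%:R + a + 3 / 2) * M)).
  by ring.
by rewrite e; field.
Qed.

Lemma struve_cosine_transform a x : 1 / 2 < a -> 0 < x ->
  struve a x = (x / 2) `^ (a + 1) *
   ((2 * a + 1) / (Gamma (3 / 2) * Gamma (a + 3 / 2)) / x ^+ 2 *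
    cosine_transform (a - 1 / 2)^-1 x).
Proof.
move=> ha x0; rewrite /struve; congr (_ * _).
set g := (a - 1 / 2)^-1.
set D := _ / _ / x ^+ 2.
have g0 : 0 < g by rewrite invr_gt0 subr_gt0.
apply/cvg_lim => //.
have : D * \sum_(0 <= k < n) ((-1) ^+ k * x ^+ k.+1.*2 * moment g k.+1 / (k.+1.*2)`!%:R)
    @[n --> \oo] --> D * cosine_transform g x.
  by apply: cvgMr; exact: cvg_cosine_transform.
apply: cvg_trans; apply: near_eq_cvg; apply: nearW => n /=.
rewrite big_distrr/=; apply: eq_bigr => k _.
have a1 : 2 * a + 1 != 0 by apply: lt0r_neq0; lra.
have k0 : (0 : R) <= k%:R by rewrite ler0n.
have h1 : (1 : R) < 3 / 2 by lra.
have h2 : 1 < a + 3 / 2 by lra.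
have h3 : (1 : R) < k%:R + 3 / 2 by lra.
have h4 : 1 < k%:R + a + 3 / 2 by lra.
have [G1 G2 G3 G4] := And4 (Gamma_gt0 h1) (Gamma_gt0 h2) (Gamma_gt0 h3) (Gamma_gt0 h4).
have f0 : ((k.+1.*2)`!%:R : R) != 0 by rewrite pnatr_eq0 -lt0n fact_gt0.
have H := Gamma_moment k ha; rewrite -/g in H.
have -> : (x / 2) ^+ (2 * k) = x ^+ (2 * k) / 4 ^+ k.
  by rewrite exprMn exprVn [2 ^+ _]exprM; congr (_ / _ ^+ _); rewrite expr2; ring.
have -> : x ^+ k.+1.*2 = x ^+ 2 * x ^+ (2 * k) by rewrite -exprD mul2n doubleS.
have p4 : (4 : R) ^+ k != 0 by rewrite expf_neq0// pnatr_eq0.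
have x20 := gt_eqF x0.
rewrite /D; move: (Gamma _) (Gamma _) (Gamma _) (Gamma _) G1 G2 G3 G4 H => A B A' B' A0 B0 A'0 B'0.
move: ((-1) ^+ k) (x ^+ (2 * k)) (moment g k.+1) ((k.+1.*2)`!%:R) f0 (4 ^+ k) p4.
move=> sg w M f f0 p p0 H.
have -> : M = f * (B' * A') / (B * A * p * (2 * a + 1)).
  by rewrite -H; field; rewrite a1 p0 !gt_eqF.
by field; rewrite a1 p0 f0 x20 !gt_eqF.
Qed.

(** The Struve function is x^(a - 1) times the averaged cosine, up to a constant;
    the square root contributes the missing half power. *)
Lemma struve_kernelE a z : 1 / 2 < a -> 0 < z ->
  struve_kernel a z = (2 * a + 1) / (Gamma (3 / 2) * Gamma (a + 3 / 2)) / 2 `^ (a + 1) *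
    (z `^ (a - 1 / 2) * cosine_transform (a - 1 / 2)^-1 z).
Proof.
move=> ha z0; rewrite /struve_kernel struve_cosine_transform//.
have p0 : 0 < 2 `^ (a + 1) :> R by rewrite powR_gt0.
have h1 : (1 : R) < 3 / 2 by lra.
have h2 : 1 < a + 3 / 2 by lra.
have [G1 G2] := conj (Gamma_gt0 h1) (Gamma_gt0 h2).
rewrite powRM ?invr_ge0 ?(ltW z0)// -powR12_sqrt ?(ltW z0)//.
have -> : 2^-1 `^ (a + 1) = (2 `^ (a + 1))^-1 :> R.
  by rewrite -powR_inv1// -powRrM mulN1r powRN.
have zn : z != 0 by rewrite gt_eqF.
have -> : z `^ (a + 1) = z `^ (a - 1 / 2) * z `^ (2^-1) * z.
  rewrite -[X in _ * X](powRr1 (ltW z0)) -!powRD ?zn ?implybT//.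
  by congr (_ `^ _); field.
have -> : z ^+ 2 = z `^ (2^-1) * z `^ (2^-1) * z.
  rewrite -powRD ?zn ?implybT// (_ : 2^-1 + 2^-1 = 1) ?powRr1 ?(ltW z0) ?expr2//.
  by rewrite -[RHS](@mulVf _ 2)// mulr_natr.
have zh : z `^ 2^-1 != 0 by rewrite gt_eqF// powR_gt0.
move: (Gamma _) (Gamma _) (cosine_transform _ _) G1 G2 (z `^ 2^-1) zh (2 `^ _) p0.
move=> A B K A0 B0 w w0 p p0.
by field; rewrite w0 zn !gt_eqF.
Qed.

(** The averaged cosine is comparable to min (z^2, 1), so the kernel is positive
    and comparable to min (z^(a + 3/2), z^(a - 1/2)). Each power is an upper
    bound for every z, and is a lower bound on its own side of 1. *)
Lemma struve_kernel_bounds a : 1 / 2 < a -> exists c C : R, [/\ 0 < c, 0 < C,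
  forall z, 0 < z -> 0 <= struve_kernel a z,
  forall b z, 0 < z -> struve_kernel a z <= C * z `^ kernel_exponent a b &
  forall b z, 0 < z -> half_line b 1 z -> c * z `^ kernel_exponent a b <= struve_kernel a z].
Proof.
move=> ha; set g := (a - 1 / 2)^-1.
have g0 : 0 < g by rewrite invr_gt0 subr_gt0.
have [c0 [c00 Hs Hl]] := cosine_transform_lower g0.
pose D : R := (2 * a + 1) / (Gamma (3 / 2) * Gamma (a + 3 / 2)) / 2 `^ (a + 1).
have h1 : (1 : R) < 3 / 2 by lra.
have h2 : 1 < a + 3 / 2 by lra.
have D0 : 0 < D.
  apply: divr_gt0; last by rewrite powR_gt0.
  apply: divr_gt0; first by lra.
  exact: mulr_gt0 (Gamma_gt0 h1) (Gamma_gt0 h2).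
have kE z : 0 < z -> struve_kernel a z = D * (z `^ (a - 1 / 2) * cosine_transform g z).
  exact: struve_kernelE.
have eE z : 0 < z -> z `^ (a + 3 / 2) = z `^ (a - 1 / 2) * z ^+ 2.
  move=> z0; have zn : z != 0 by rewrite gt_eqF.
  rewrite -powR_mulrn ?(ltW z0)// -powRD ?zn ?implybT//.
  by congr (_ `^ _); field.
exists (D * c0), (D * 2); split.
- by rewrite mulr_gt0 ?D0 ?c00.
- by rewrite mulr_gt0 ?D0.
- move=> z z0; rewrite kE// mulr_ge0 ?(ltW D0)// mulr_ge0 ?powR_ge0//.
  have [z1|z1] := leP z 1; first by apply: le_trans (Hs _ z0 z1); rewrite mulr_ge0 ?sqr_ge0 ?(ltW c00).
  by apply: le_trans (Hl _ (ltW z1)); exact: ltW.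
- move=> b z z0; rewrite kE// -mulrA ler_wpM2l ?(ltW D0)//.
  have w0 := powR_ge0 z (a - 1 / 2).
  case: b; rewrite /kernel_exponent ?eE//.
    rewrite mulrCA ler_wpM2l//.
    by have := cosine_transform_le_sqr z g0; have := sqr_ge0 z; lra.
  rewrite mulrC ler_wpM2r//; exact: cosine_transform_le2.
- move=> b z z0 bz; rewrite kE// -mulrA ler_wpM2l ?(ltW D0)//.
  have w0 := powR_ge0 z (a - 1 / 2).
  case: b bz; rewrite /half_line /kernel_exponent/= in_itv/= ?eE// => /andP[l1 l2].
    by rewrite mulrCA ler_wpM2l// Hs// ltW.
  by rewrite mulrC ler_wpM2l// Hl// ltW.
Qed.

Lemma measurable_cosine_transform (g : R) : 0 < g ->
  measurable_fun [set: R] (cosine_transform g).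
Proof.
move=> g0; apply: (@measurable_fun_cvg _ _ _ _ (fun n x =>
  \sum_(0 <= k < n) ((-1) ^+ k * x ^+ k.+1.*2 * moment g k.+1 / (k.+1.*2)`!%:R))).
  move=> n; apply: measurable_sum => k.
  apply: measurable_funM => //; apply: measurable_funM => //; apply: measurable_funM => //.
by move=> x _; exact: cvg_cosine_transform.
Qed.

Lemma measurable_struve_kernel a : 1 / 2 < a ->
  measurable_fun (Rplus R) (struve_kernel a).
Proof.
move=> ha; pose D : R := (2 * a + 1) / (Gamma (3 / 2) * Gamma (a + 3 / 2)) / 2 `^ (a + 1).
apply: (eq_measurable_fun (fun z => D * (z `^ (a - 1 / 2) * cosine_transform (a - 1 / 2)^-1 z))).
  by move=> z; rewrite inE/= in_itv/= andbT => z0; rewrite struve_kernelE.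
apply: measurable_funTS; apply: measurable_funM => //; apply: measurable_funM.
  exact: measurable_powR.
by apply: measurable_cosine_transform; rewrite invr_gt0 subr_gt0.
Qed.

End kernel.

(** * The transform between weighted spaces *)

Section struve_operator.
Context {R : realType}.
Local Notation mu := (@lebesgue_measure R).
Variables (a : R) (p q : \bar R) (u v : R -> R).
Hypotheses (ha : 1 / 2 < a) (p1 : (1 <= p)%E) (pq : (p <= q)%E).
Hypotheses (hu : weight u) (hv : weight v).
Implicit Types (b : bool) (f : R -> R) (t x y : R).

Definition hardy_condition b : Prop := exists2 B : R, 0 <= B &
  forall t, 0 < t ->
    (Lnorm_on q (half_line b t^-1) (fun x => x `^ kernel_exponent a b * u x)%R *
     Lnorm_on (hoelder_conjugate p) (half_line b t)
       (fun x => x `^ kernel_exponent a b * (v x)^-1)%R <= B%:E)%E.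

Let q1 : (1 <= q)%E. Proof. exact: le_trans pq. Qed.
Let p0 : (0 < p)%E. Proof. exact: lt_le_trans p1. Qed.
Let q0 : (0 < q)%E. Proof. exact: lt_le_trans q1. Qed.

Let mu_ : measurable_fun (Rplus R) u. Proof. by case: hu => _ []. Qed.
Let mv : measurable_fun (Rplus R) v. Proof. by case: hv => _ []. Qed.
Let u0 x : 0 < x -> 0 < u x. Proof. by case: hu => + _; apply. Qed.
Let v0 x : 0 < x -> 0 < v x. Proof. by case: hv => + _; apply. Qed.

Let mpow (e : R) : measurable_fun (Rplus R) (fun x : R => x `^ e).
Proof. exact: measurable_funTS (measurable_powR _). Qed.

Lemma Lnorm_onD (E : set R) (f g : R -> R) : measurable E ->
  measurable_fun E f -> measurable_fun E g ->
  (Lnorm_on q E (fun x => (f x + g x)%R) <= Lnorm_on q E f + Lnorm_on q E g)%E.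
Proof.
move=> mE mf mg; rewrite !Lnorm_onE.
have -> : (fun x => f x + g x) \_ E = (f \_ E) \+ (g \_ E).
  by apply/funext => x; rewrite /= !patchE; case: ifPn => //; rewrite addr0.
by apply: eminkowski => //; apply/(measurable_restrictT _ mE).
Qed.

Lemma struve_integrandE f x y : struve_integrand a f y x = f x * struve_kernel a (x * y).
Proof. by rewrite /struve_integrand /struve_kernel [RHS]mulrA (mulrC (f x)). Qed.

Let h b f x := x `^ kernel_exponent a b * `|f x|.

(** The integral is split at x = 1/y, that is, where the argument x y of the
    kernel is 1, with the corresponding power bound on either side. The bound
    holds for every truncated integral, hence for its limit. *)
Lemma struve_transform_le (C : R) f y : 0 <= C ->
  (forall z, 0 < z -> 0 <= struve_kernel a z) ->
  (forall b z, 0 < z -> struve_kernel a z <= C * z `^ kernel_exponent a b) ->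
  0 < y -> measurable_fun (Rplus R) f -> struve_admissible a f ->
  (forall b, primitive b (h b f) y^-1 < +oo)%E ->
  `|struve_transform a f y| <=
    C * (y `^ kernel_exponent a true * fine (primitive true (h true f) y^-1) +
         y `^ kernel_exponent a false * fine (primitive false (h false f) y^-1)).
Proof.
move=> C0 k0 kC y0 mf /(_ y y0)[[mI _ _] [l Il]] Foo.
rewrite /struve_transform (cvg_lim _ Il)//=; set K := C * _.
have y'0 : 0 < y^-1 by rewrite invr_gt0.
have mh b (A : set R) : A `<=` Rplus R -> measurable_fun A (fun x => (h b f x)%:E).
  move=> AP; apply/measurable_EFinP; apply: (measurable_funS _ AP) => //.
  by apply: measurable_funM => //; exact: measurableT_comp.
have F0 b : (0 <= primitive b (h b f) y^-1)%E.
  by apply: integral_ge0 => x _; rewrite lee_fin mulr_ge0 ?powR_ge0.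
have FE b : primitive b (h b f) y^-1 = (fine (primitive b (h b f) y^-1))%:E.
  by rewrite fineK// ge0_fin_numE.
have mIE (A : set R) : A `<=` Rplus R -> measurable_fun A (fun x => `|(struve_integrand a f y x)%:E|%E).
  move=> AP; apply: measurableT_comp => //; apply/measurable_EFinP.
  by apply: (measurable_funS _ AP).
have piece b (A : set R) : measurable A -> A `<=` Rplus R ->
    (\int[mu]_(x in A) `|(struve_integrand a f y x)%:E| <=
     (C * y `^ kernel_exponent a b)%:E * \int[mu]_(x in A) (h b f x)%:E)%E.
  move=> mA AP; have CY : 0 <= C * y `^ kernel_exponent a b by rewrite mulr_ge0 ?powR_ge0.
  rewrite -ge0_integralZl_EFin//; [|by move=> x _; rewrite lee_fin mulr_ge0 ?powR_ge0|exact: mh].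
  apply: ge0_le_integral => //; [exact: mIE|by apply: measurable_funeM; exact: mh|].
  move=> x /AP; rewrite /= in_itv/= andbT => x0; rewrite lee_fin struve_integrandE normrM.
  have xy0 : 0 < x * y by rewrite mulr_gt0.
  rewrite (ger0_norm (k0 _ xy0)) mulrC.
  apply: le_trans (ler_wpM2r (normr_ge0 _) (kC b _ xy0)) _.
  rewrite powRM ?(ltW x0) ?(ltW y0)// /h le_eqVlt; apply/orP; left; apply/eqP; ring.
have total : (\int[mu]_(x in Rplus R) `|(struve_integrand a f y x)%:E| <= K%:E)%E.
  have i1 : `]0, y^-1]%classic `<=` Rplus R.
    by move=> x /=; rewrite !in_itv/= andbT => /andP[].
  have i2 : `]y^-1, +oo[%classic `<=` Rplus R.
    by move=> x /=; rewrite !in_itv/= !andbT; exact: lt_trans.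
  have split0 : Rplus R = `]0, y^-1]%classic `|` `]y^-1, +oo[%classic.
    by rewrite -itv_bndbnd_setU// bnd_simp ltW.
  rewrite [in leLHS]split0 ge0_integral_setU//; last 2 first.
  - by rewrite -split0; exact: mIE.
  - apply/disj_set2P; rewrite -subset0 => z/=; rewrite !in_itv/= => -[/andP[_]].
    by rewrite leNgt => /negbTE ->.
  have -> : K%:E = ((C * y `^ kernel_exponent a true)%:E * primitive true (h true f) y^-1 +
      (C * y `^ kernel_exponent a false)%:E * primitive false (h false f) y^-1)%E.
    rewrite (FE true) (FE false) /K; move: (fine _) (fine _) => F1 F2; rewrite -!EFinM -EFinD.
    by congr (_%:E); rewrite mulrDr !mulrA.
  apply: leeD.
    apply: le_trans (piece true _ _ i1) _ => //.
    rewrite lee_wpmul2l ?lee_fin ?mulr_ge0 ?powR_ge0// /primitive /half_line.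
    rewrite integral_itv_bndo_bndc//; apply: mh; apply: subset_trans i1.
    by apply: subset_itvl; rewrite bnd_simp.
  by apply: le_trans (piece false _ _ i2) _.
have partial N : (`|struve_partial a f y N| <= K%:E)%E.
  apply: le_trans total.
  have NP : `]0, N[%classic `<=` Rplus R by move=> x /=; rewrite !in_itv/= andbT => /andP[].
  apply: le_trans (le_abse_integral _ _ _) _.
  - exact: measurable_itv.
  - by apply/measurable_EFinP; apply: (measurable_funS _ NP).
  by apply: ge0_subset_integral => //; exact: mIE.
rewrite -lee_fin; have /andP[lo hi] : ((- K)%:E <= l%:E <= K%:E)%E.
  by apply/andP; split; [apply: (cvge_ge _ Il)|apply: (cvge_le _ Il)];
    apply: nearW => N; move: (partial N); case: (struve_partial a f y N) => [r||] //=;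
    rewrite !lee_fin ler_norml => /andP[].
by rewrite lee_fin ler_norml -!lee_fin lo.
Qed.

Lemma eq_abs_Lnorm_on (r : \bar R) (E : set R) (f g : R -> R) : (0 < r)%E ->
  (forall x, E x -> `|f x| = `|g x|) -> Lnorm_on r E f = Lnorm_on r E g.
Proof.
by move=> r0 fg; apply/eqP; rewrite eq_le !le_Lnorm_on// => x /fg ->.
Qed.

(** The Hardy inequality applies to h = x^e |f| with weights U = x^e u and
    V = v x^(- e), for either exponent e of the kernel: then V h = v |f|, and
    the hypothesis on U and 1/V is the assumed condition. *)
Lemma hardy_conditions_sufficient : (forall b, hardy_condition b) ->
  exists C : R, 0 < C /\ forall f, in_weighted_Lp p v f -> struve_admissible a f ->
    (wnorm q u (struve_transform a f) <= C%:E * wnorm p v f)%E.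
Proof.
move=> hc; have [_ [C [_ C0 k0 kC _]]] := struve_kernel_bounds ha.
have /choice[B BP] : forall b, exists B : R, 0 <= B /\ forall t, 0 < t ->
    (Lnorm_on q (half_line b t^-1) (fun x => x `^ kernel_exponent a b * u x)%R *
     Lnorm_on (hoelder_conjugate p) (half_line b t)
       (fun x => x `^ kernel_exponent a b * (v x)^-1)%R <= B%:E)%E.
  by move=> b; have [B] := hc b; exists B.
have B0 b : 0 <= B b by have [] := BP b.
(* the summand 1 makes the constant positive even when both B vanish *)
exists (C * (4 * B true + 4 * B false) + 1); split.
  by rewrite ltr_wpDl// mulr_ge0 ?(ltW C0)// addr_ge0// mulr_ge0.
move=> f [mf foo] fa; set N := wnorm p v f in foo *.
have N0 : (0 <= N)%E by exact: Lnorm_on_ge0.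
pose U b x := x `^ kernel_exponent a b * u x.
pose V b x := v x * (x `^ kernel_exponent a b)^-1.
have pow0 b x : 0 < x -> 0 < x `^ kernel_exponent a b by exact: powR_gt0.
have mU b : measurable_fun (Rplus R) (U b) by exact: measurable_funM.
have mV b : measurable_fun (Rplus R) (V b).
  by apply: measurable_funM => //; apply: measurable_inv_pos => //; exact: pow0.
have mh b : measurable_fun (Rplus R) (h b f).
  by apply: measurable_funM => //; exact: measurableT_comp.
have U0 b x : 0 < x -> 0 < U b x by move=> x0; rewrite mulr_gt0 ?pow0 ?u0.
have V0 b x : 0 < x -> 0 < V b x by move=> x0; rewrite mulr_gt0 ?invr_gt0 ?pow0 ?v0.
have h0 b x : 0 < x -> 0 <= h b f x by rewrite mulr_ge0 ?powR_ge0.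
have UVB b t : 0 < t -> (Lnorm_on q (half_line b t^-1%R) (U b) *
    Lnorm_on (hoelder_conjugate p) (half_line b t) (fun x => (V b x)^-1%R) <= (B b)%:E)%E.
  move=> t0; have [_ /(_ t t0)] := BP b; congr (_ * _ <= _)%E.
  by apply: eq_Lnorm_on => x _; rewrite /V invfM invrK mulrC.
have VhN b : Lnorm_on p (Rplus R) (fun x => V b x * h b f x) = N.
  apply: eq_abs_Lnorm_on => // x; rewrite /= in_itv/= andbT => x0.
  rewrite /V /h mulrA divfK ?gt_eqF ?pow0// normrM normr_id -normrM//.
have Vhoo b : (Lnorm_on p (Rplus R) (fun x => V b x * h b f x)%R < +oo)%E by rewrite VhN.
pose F b y := U b y * fine (primitive b (h b f) y^-1).
have FN b : (Lnorm_on q (Rplus R) (F b) <= (4 * B b)%:E * N)%E.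
  rewrite -(VhN b); exact: (hardy_inequality p1 pq (B0 b) (mU b) (mV b) (mh b)
    (@U0 b) (@V0 b) (@h0 b) (@UVB b) (Vhoo b)).
have Foo b t : 0 < t -> (primitive b (h b f) t < +oo)%E.
  exact: (primitive_lty p1 pq (mU b) (mV b) (mh b)
    (@U0 b) (@V0 b) (@h0 b) (@UVB b) (Vhoo b)).
have mF b : measurable_fun (Rplus R) (F b).
  by apply: measurable_funM => //; exact: (measurable_primitive_inv (mh b) (@h0 b) (@Foo b)).
apply: (@le_trans _ _ (Lnorm_on q (Rplus R) (fun y => C * (F true y + F false y))%R)).
  apply: le_Lnorm_on => // y; rewrite /= in_itv/= andbT => y0.
  have F0 b : 0 <= F b y.
    rewrite mulr_ge0 ?(ltW (U0 b _ y0))// fine_ge0// integral_ge0// => x xE.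
    have y'0 : 0 < y^-1 by rewrite invr_gt0.
    by have := half_line_gt0 y'0 xE; rewrite /= in_itv/= andbT lee_fin; exact: h0.
  rewrite normrM [leRHS]ger0_norm; last by rewrite mulr_ge0 ?(ltW C0)// addr_ge0.
  rewrite (ger0_norm (ltW (u0 y0))).
  have y'0 : 0 < y^-1 by rewrite invr_gt0.
  have := struve_transform_le (ltW C0) k0 kC y0 mf fa (fun b => Foo b _ y'0).
  move=> /(ler_wpM2l (ltW (u0 y0))) /le_trans; apply.
  rewrite /F /U; move: (fine _) (fine _) => F1 F2.
  by rewrite le_eqVlt; apply/orP; left; apply/eqP; ring.
rewrite Lnorm_onZl ?(ltW C0)//; last exact: measurable_funD.
apply: (@le_trans _ _ (C%:E * ((4 * B true)%:E * N + (4 * B false)%:E * N))%E).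
  rewrite lee_wpmul2l ?lee_fin ?(ltW C0)//.
  by apply: le_trans (Lnorm_onD _ (mF true) (mF false)) _ => //; exact: leeD.
rewrite -ge0_muleDl ?lee_fin ?mulr_ge0// -EFinD muleA -EFinM.
by rewrite lee_wpmul2r// lee_fin lerDl.
Qed.

Lemma bounded_integral_lty (A : set R) (G : R -> R) (K N : R) : 0 <= K ->
  (forall x, A x -> 0 <= G x <= K) -> (forall x, A x -> G x != 0 -> 0 < x < N) ->
  (\int[mu]_(x in A) (G x)%:E < +oo)%E.
Proof.
move=> K0 GK GN; apply: (@le_lt_trans _ _ (\int[mu]_(x in `]0%R, N[) K%:E)%E).
  rewrite [leLHS]integral_mkcond [leRHS]integral_mkcond; apply: ge0_le_integralT => x.
    by rewrite patchE; case: ifPn => //; rewrite inE lee_fin => /GK/andP[].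
  rewrite !patchE; case: ifPn => [|_]; last by case: ifPn => // _; rewrite lee_fin.
  rewrite inE => Ax; have /andP[g0 gK] := GK _ Ax.
  have [->|gn] := eqVneq (G x) 0; first by case: ifPn => // _; rewrite lee_fin.
  by rewrite mem_set ?lee_fin//= in_itv/=; exact: GN.
have -> : (\int[mu]_(x in `]0%R, N[) K%:E = K%:E * mu `]0%R, N[)%E by rewrite integral_cst.
rewrite lte_mul_pinfty ?lee_fin// lebesgue_measure_itv/=; case: ifPn => _; last exact: ltry.
by rewrite -EFinB ltry.
Qed.

(** Where x and y lie in these half lines, the lower bound of the kernel at x y
    is available. *)
Lemma half_line_mul b t x y : 0 < t -> half_line b t x -> half_line b t^-1 y ->
  half_line b 1 (x * y).
Proof.
move=> t0; have t1 : t * t^-1 = 1 by rewrite divff// gt_eqF.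
have t'0 : 0 < t^-1 by rewrite invr_gt0.
rewrite !half_lineP; case: b => [/andP[x0 xt] /andP[y0 yt]|xt yt].
  by rewrite mulr_gt0//= -t1 ltr_pM// ltW.
by rewrite -t1 ltr_pM// ltW.
Qed.

(** Since the kernel is nonnegative, testing on f = phi / v >= 0 with phi
    supported in the half line E at t gives, for y in the half line at 1/t,
    a transform of at least c y^e times the integral of x^e phi / v over E,
    whence A times this integral is at most C / c times the norm of phi, A
    being the norm of x^e u over the half line at 1/t. The converse of
    Hölder's inequality turns this into the condition, with g = x^e / v.
    For phi bounded, of bounded support and with g bounded there, f is
    admissible. *)
Lemma hardy_conditions_necessary (C : R) b : 0 < C ->
  (forall f, in_weighted_Lp p v f -> struve_admissible a f ->
    (wnorm q u (struve_transform a f) <= C%:E * wnorm p v f)%E) ->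
  hardy_condition b.
Proof.
move=> C0 H; have [c [D [c0 D0 k0 kD kc]]] := struve_kernel_bounds ha.
have Cc0 : 0 < C / c by rewrite divr_gt0.
exists (C / c); first exact: ltW.
move=> t t0; set e := kernel_exponent a b in kD kc *.
pose E := half_line b t; have mE : measurable E by exact: measurable_half_line.
have EP : E `<=` Rplus R by exact: half_line_gt0.
have E0 x : E x -> 0 < x by move=> /EP; rewrite /= in_itv/= andbT.
have t'0 : 0 < t^-1 by rewrite invr_gt0.
set A := Lnorm_on q _ _.
pose g x := x `^ e * (v x)^-1.
have mg : measurable_fun (Rplus R) g.
  by apply: measurable_funM => //; exact: measurable_inv_pos.
have g0 x : 0 < x -> 0 < g x by move=> x0; rewrite mulr_gt0 ?powR_gt0// invr_gt0 v0.
apply: (converse_hoelder p1 mE EP) => //.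
- exact: measurable_funS mg.
- by move=> x /E0 x0; exact: ltW (g0 _ x0).
- exact: Lnorm_on_ge0.
- exact: ltW.
move=> n M phi mphi phiM phiS.
have [->|Phioo] := eqVneq (Lnorm_on p E phi) +oo%E.
  by rewrite gt0_muley ?leey// lte_fin.
have phi0 x : 0 <= phi x by have /andP[] := phiM x.
pose f x := phi x * (v x)^-1.
have mf : measurable_fun (Rplus R) f.
  by apply: measurable_funM => //; [exact: measurable_funTS|exact: measurable_inv_pos].
have phi_out x : ~ E x -> phi x = 0.
  by move=> nE; apply/eqP/negPn/negP => /phiS[].
have vfphi : wnorm p v f = Lnorm_on p E phi.
  rewrite /wnorm !Lnorm_onE; apply: eq_Lnorm => x; rewrite /= !patchE.
  have [xE|xE] := pselect (E x).
    rewrite !mem_set//; last exact: EP.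
    by rewrite /f mulrCA divff ?mulr1// gt_eqF// v0// E0.
  rewrite (memNset xE); case: ifPn => // _.
  by rewrite /f phi_out// mul0r mulr0.
have fLp : in_weighted_Lp p v f by split => //; rewrite vfphi ltey.
have f0 x : 0 < x -> 0 <= f x by move=> x0; rewrite mulr_ge0 ?phi0// invr_ge0 ltW// v0.
pose I y := struve_integrand a f y.
have mI y : 0 < y -> measurable_fun (Rplus R) (I y).
  move=> y0; apply: (eq_measurable_fun (fun x => f x * (struve_kernel a \_ (Rplus R)) (x * y))).
    move=> x; rewrite inE/= in_itv/= andbT => x0; rewrite /I struve_integrandE patchE mem_set//=.
    by rewrite in_itv/= andbT mulr_gt0.
  apply: measurable_funM => //; apply: measurable_funTS.
  apply: (@measurableT_comp _ _ _ _ _ _ (struve_kernel a \_ (Rplus R)) _ (fun x => x * y)).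
    by apply/(measurable_restrictT _ (measurable_itv _)); exact: measurable_struve_kernel.
  exact: measurable_funM.
have I0 y x : 0 < y -> 0 < x -> 0 <= I y x.
  by move=> y0 x0; rewrite /I struve_integrandE mulr_ge0 ?f0// k0// mulr_gt0.
have M0 : 0 <= M by have /andP[] := phiM 0; exact: le_trans.
have gM x : 0 < x -> g x * phi x <= n%:R * M.
  move=> x0; have [->|/phiS[Ex xn gn]] := eqVneq (phi x) 0; first by rewrite mulr0 mulr_ge0.
  by have /andP[_ ?] := phiM x; rewrite ler_pM// ltW// g0.
have gI y x : 0 < y -> 0 < x -> f x * (x * y) `^ e = y `^ e * (g x * phi x).
  by move=> y0 x0; rewrite powRM ?(ltW x0) ?(ltW y0)// /f /g; ring.
have intI y : 0 < y -> mu.-integrable (Rplus R) (EFin \o I y).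
  move=> y0; apply/integrableP; split; first by apply/measurable_EFinP; exact: mI.
  apply: (@bounded_integral_lty _ (fun x => `|I y x|) (D * (y `^ e * (n%:R * M))) n%:R).
  - by rewrite mulr_ge0 ?(ltW D0)// mulr_ge0 ?powR_ge0// mulr_ge0.
  - move=> x; rewrite /= in_itv/= andbT => x0; rewrite normr_ge0/= ger0_norm ?I0//.
    have xy0 : 0 < x * y by rewrite mulr_gt0.
    rewrite /I struve_integrandE; apply: le_trans (ler_wpM2l (f0 _ x0) (kD b _ xy0)) _.
    by rewrite mulrCA gI// ler_wpM2l ?(ltW D0)// ler_wpM2l ?powR_ge0// gM.
  - move=> x; rewrite /= in_itv/= andbT => x0; rewrite normr_eq0 /I struve_integrandE x0/=.
    have [p0x|/phiS[_ xn _] _] := eqVneq (phi x) 0; last by [].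
    by rewrite /f p0x !mul0r eqxx.
(* f vanishes beyond n, so the truncated integrals are eventually constant *)
have lim y : 0 < y -> struve_partial a f y N @[N --> +oo%R] -->
    (\int[mu]_(x in Rplus R) I y x)%:E.
  move=> y0; apply: cvg_near_cst; near=> N.
  have nN : n%:R < N by near: N; exact: nbhs_pinfty_gt.
  rewrite /Rintegral fineK; last by apply: integrable_fin_num (intI _ y0).
  rewrite /struve_partial [LHS]integral_mkcond [RHS]integral_mkcond.
  apply: eq_integral => x _; rewrite !patchE.
  have [xP|xP] := pselect (Rplus R x); last first.
    rewrite (memNset xP) memNset// => xN; apply: xP.
    by move: xN; rewrite /= !in_itv/= andbT => /andP[].
  rewrite [in RHS]mem_set//; case: ifPn => // /negP xN.
  rewrite /I struve_integrandE /f (_ : phi x = 0) ?mul0r//.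
  apply/eqP/negPn/negP => /phiS[_ xn _]; apply: xN; rewrite inE /= in_itv/=.
  by move: xP; rewrite /= in_itv/= andbT => -> /=; exact: lt_trans xn nN.
have fa : struve_admissible a f.
  move=> y y0; split; last by exists (\int[mu]_(x in Rplus R) I y x); exact: lim.
  apply: open_integrable_locally; first exact: interval_open.
  exact: intI.
have transformE y : 0 < y -> struve_transform a f y = \int[mu]_(x in Rplus R) I y x.
  by move=> y0; rewrite /struve_transform (cvg_lim _ (lim _ y0)).
pose J := (\int[mu]_(x in E) (g x * phi x)%:E)%E.
have J0 : (0 <= J)%E.
  by apply: integral_ge0 => x /E0 x0; rewrite lee_fin mulr_ge0// ltW// g0.
have Joo : (J < +oo)%E.
  apply: (@bounded_integral_lty _ _ (n%:R * M) n%:R); first by rewrite mulr_ge0.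
  - by move=> x /E0 x0; rewrite mulr_ge0 ?gM//= ltW// g0.
  - move=> x /E0 x0; rewrite mulf_eq0 negb_or x0/= => /andP[_ /phiS[]//].
pose j := fine J; have JE : J = j%:E by rewrite fineK// ge0_fin_numE.
have j0 : 0 <= j by exact: fine_ge0.
have lower y : half_line b t^-1 y -> c * (y `^ e * j) <= struve_transform a f y.
  move=> yE; have y0 : 0 < y by have := half_line_gt0 t'0 yE; rewrite /= in_itv/= andbT.
  rewrite transformE// -lee_fin /Rintegral fineK; last exact: integrable_fin_num (intI _ y0).
  rewrite mulrA EFinM -JE /J -ge0_integralZl_EFin//.
  - rewrite [leLHS]integral_mkcond [leRHS]integral_mkcond.
    apply: ge0_le_integralT => x; rewrite !patchE.
      case: ifPn => //; rewrite inE => /E0 x0.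
      have gx := ltW (g0 _ x0).
      rewrite lee_fin; apply: mulr_ge0; last exact: mulr_ge0.
      by rewrite mulr_ge0 ?powR_ge0 ?(ltW c0).
    case: ifPn => [|_]; last first.
      by case: ifPn => //; rewrite inE /= in_itv/= andbT => x0; rewrite lee_fin I0.
    rewrite inE => xE; have x0 := E0 _ xE; rewrite mem_set; last exact: EP.
    have xy0 : 0 < x * y by rewrite mulr_gt0.
    rewrite -EFinM lee_fin -mulrA -gI// /I struve_integrandE mulrCA.
    by rewrite ler_wpM2l ?f0// kc//; exact: half_line_mul t0 xE yE.
  - by move=> x /E0 x0; rewrite lee_fin mulr_ge0// ltW// g0.
  - apply/measurable_EFinP; apply: measurable_funM; last exact: measurable_funTS.
    by apply: measurable_funS mg => //; exact: measurable_itv.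
  - by rewrite mulr_ge0 ?powR_ge0 ?(ltW c0).
have := H f fLp fa; rewrite vfphi => HH.
have : ((c * j)%:E * A <= C%:E * Lnorm_on p E phi)%E.
  apply: le_trans HH; rewrite -Lnorm_onZl ?mulr_ge0 ?(ltW c0)//.
  - apply: le_Lnorm_on => //; first exact: half_line_gt0.
    move=> y yE; have y0 : 0 < y by have := half_line_gt0 t'0 yE; rewrite /= in_itv/= andbT.
    have ly := lower _ yE.
    have l0 : 0 <= c * (y `^ e * j) by rewrite mulr_ge0 ?(ltW c0)// mulr_ge0 ?powR_ge0.
    rewrite !ger0_norm; last 2 first.
      by rewrite mulr_ge0 ?(ltW (u0 y0))// (le_trans l0).
      by rewrite !mulr_ge0 ?powR_ge0 ?(ltW (u0 y0)) ?(ltW c0).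
    apply: le_trans (ler_wpM2l (ltW (u0 y0)) ly).
    by rewrite le_eqVlt; apply/orP; left; apply/eqP; ring.
  - exact: measurable_half_line.
  - apply: measurable_funS (half_line_gt0 t'0) _; first exact: measurable_itv.
    exact: measurable_funM.
rewrite -[X in (A * X)%E]/J JE.
have -> : (C / c)%:E = (c^-1%:E * C%:E)%E by rewrite -EFinM mulrC.
by rewrite -muleA lee_pdivlMl// muleCA -EFinM muleC.
Unshelve. all: by end_near.
Qed.

End struve_operator.

Lemma ereal_sup_ltyP (R : realType) (f : R -> \bar R) :
  (forall t : R, 0 < t -> (0 <= f t)%E) ->
  (ereal_sup [set f t | t in Rplus R] < +oo)%E <->
  exists2 B : R, 0 <= B & forall t, 0 < t -> (f t <= B%:E)%E.
Proof.
move=> f0; split => [supoo|[B B0 fB]]; last first.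
  apply: le_lt_trans (ltry B); apply: ge_ereal_sup => _ [t + <-].
  by rewrite /= in_itv/= andbT; exact: fB.
set s := ereal_sup _ in supoo *.
have fs t : 0 < t -> (f t <= s)%E.
  by move=> t0; apply: ereal_sup_ubound; exists t => //=; rewrite in_itv/= t0.
have s0 : (0 <= s)%E by apply: le_trans (fs 1 ltr01); exact: f0.
exists (fine s); first exact: fine_ge0.
by move=> t t0; rewrite fineK ?ge0_fin_numE//; exact: fs.
Qed.

Theorem theorem5p1 (R : realType) (a : R) (p q : \bar R) (u v : R -> R)
    (ha : 1 / 2 < a) (hp : (1 <= p)%E) (hpq : (p <= q)%E)
    (hu : weight u) (hv : weight v) :
  (exists C : R, 0 < C /\
     forall f : R -> R, in_weighted_Lp p v f -> struve_admissible a f ->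
       (wnorm q u (struve_transform a f) <= C%:E * wnorm p v f)%E)
  <->
  (ereal_sup [set
     (Lnorm_on q `]0%R, (t^-1)%R[ (fun x => (x `^ (a + 3 / 2) * u x)%R) *
      Lnorm_on (hoelder_conjugate p) `]0%R, t[
        (fun x => (x `^ (a + 3 / 2) * (v x)^-1)%R))%E
     | t in Rplus R] < +oo)%E
  /\
  (ereal_sup [set
     (Lnorm_on q `](t^-1)%R, +oo[ (fun x => (x `^ (a - 1 / 2) * u x)%R) *
      Lnorm_on (hoelder_conjugate p) `]t, +oo[
        (fun x => (x `^ (a - 1 / 2) * (v x)^-1)%R))%E
     | t in Rplus R] < +oo)%E.
Proof.
have prod_ge0 (A B : set R) (f g : R -> R) r s : (0 <= Lnorm_on r A f * Lnorm_on s B g)%E.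
  by apply: mule_ge0; exact: Lnorm_on_ge0.
rewrite (ereal_sup_ltyP (fun t _ => prod_ge0 _ _ _ _ _ _)).
rewrite (ereal_sup_ltyP (fun t _ => prod_ge0 _ _ _ _ _ _)).
split=> [[C [C0 HC]]|[H1 H2]].
  split; first exact: (@hardy_conditions_necessary _ a p q u v ha hp hpq hu hv C true).
  exact: (@hardy_conditions_necessary _ a p q u v ha hp hpq hu hv C false).
apply: hardy_conditions_sufficient => //.
by case; [exact: H1|exact: H2].
Qed.
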